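(* Let $G=(V,E)$ be the simple graph with $V=\{1,2,3,4,5,6\}$ and $$E=\{\{1,2\},\{1,3\},\{1,4\},\{1,5\},\{1,6\},\{2,3\},\{2,4\},\{2,5\},\{3,4\},\{5,6\}\}.$$ Then for every $0<\epsilon<\frac1{10}$ there exists $0<\delta<1$ such that for every $p\in[1,1+\delta)$ there is an eigenvalue $\lambda(\Delta_p)\in(\frac59-\epsilon,\frac59+\epsilon)$ of the $p$-Laplacian $\Delta_p$ of $G$ which does not belong to any of the three lists $\{\lambda_k(\Delta_p)\}_{k=1}^6$, $\{\lambda_k^-(\Delta_p)\}_{k=1}^6$, $\{\lambda_k^+(\Delta_p)\}_{k=1}^6$.
   Context: Let $n=|V|$ and let $\deg(i)$ be the degree of vertex $i$. For $p>1$, $(\Delta_p x)_i=\sum_{j:\{i,j\}\in E}|x_i-x_j|^{p-2}(x_i-x_j)$ for $x\in\mathbb R^n$ (with $|0|^{p-2}0=0$); $\lambda\in\mathbb R$ is an eigenvalue of $\Delta_p$ if there is $x\ne 0$ with $(\Delta_p x)_i=\lambda\deg(i)|x_i|^{p-2}x_i$ for all $i$. For $p=1$, $\lambda$ is an eigenvalue of $\Delta_1$ if there are $x\neq 0$ and numbers $z_{ij}\in\mathrm{Sgn}(x_i-x_j)$, $z_{ij}=-z_{ji}$ ($\{i,j\}\in E$), with $\sum_{j:\{i,j\}\in E}z_{ij}\in\lambda\deg(i)\,\mathrm{Sgn}(x_i)$ for all $i$, where $\mathrm{Sgn}(t)=\{1\}$ if $t>0$, $[-1,1]$ if $t=0$,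 $\{-1\}$ if $t<0$. For $p\ge 1$ and $x\ne0$, $F_p(x)=\dfrac{\sum_{\{i,j\}\in E}|x_i-x_j|^p}{\sum_{i\in V}\deg(i)|x_i|^p}$. Indices. Let $S\subset\mathbb R^n\setminus\{0\}$ be compact and centrally symmetric ($-S=S$); all indices below are $0$ if $S=\varnothing$ or if $S$ is not centrally symmetric. $\gamma^-(S)$ (Krasnoselskii genus) is the least $k\ge1$ for which there is an odd continuous map $S\to\mathbb S^{k-1}$. $\gamma^+(S)$ is the largest $k\ge1$ for which there is an odd continuous map $\mathbb S^{k-1}\to S$. Yang index $\gamma(S)$: let $C_*(S)$ be the singular chain complex with $\mathbb Z_2$ coefficients, $T$ the chain map induced by $x\mapsto -x$, $C_*(S,-)=\{c: Tc=c\}$ the subcomplex of symmetric chains, with cycles $Z_q(S,-)$ and homology $H_q(S,-)$. Define homomorphisms $\nu:Z_q(S,-)\to\mathbb Z_2$ inductively: writing $z=c+Tc$, $\nu(z)=\mathrm{In}(c)$ if $q=0$ (where $\mathrm{In}(\sum n_i\sigma_i)=\sum n_i$ mod 2) and $\nu(z)=\nu(\partial c)$ if $q\ge1$. This is well defined, vanishes on boundaries and induces $\nu_*:H_q(S,-)\to\mathbb Z_2$. Then $\gamma(S)=\min\{k\in\mathbb Z^+:\nu_*H_k(S,-)=0\}$. Min-max eigenvalues: $\lambda_k(\Delta_p)=\inf_{\gamma(S)\ge k}\sup_{x\in S}F_p(x)$, $k=1,\dots,n$, the infimum over compact centrally symmetric $S\subset\mathbb R^n\setminus\{0\}$; $\lambda_k^\pm(\Delta_p)$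 are defined in the same way with $\gamma^\pm$ in place of $\gamma$. *)

(* Defs.v *)
From HB Require Import structures.
From mathcomp.multinomials Require Import freeg.
From mathcomp Require Import all_boot all_order all_algebra.
From mathcomp Require Import all_classical all_reals all_analysis.

Set Implicit Arguments.
Unset Strict Implicit.
Unset Printing Implicit Defensive.

Import Order.TTheory GRing.Theory Num.Theory numFieldNormedType.Exports.

Local Open Scope classical_set_scope.
Local Open Scope ring_scope.

(* A graph on n vertices is a symmetric irreflexive relation e on 'I_n, and a
   vector of R^n is a row vector x with entries x 0 i. *)

Definition degree (n : nat) (e : rel 'I_n) (i : 'I_n) : nat := #|[set j | e i j]%SET|.

(* For 1 < p < 2 the power |t|^(p-2) is the library's junk value at t = 0; the
   factor t makes the product 0 there, which is the convention |0|^(p-2) 0 = 0. *)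
Definition phi (R : realType) (p t : R) : R := `|t| `^ (p - 2) * t.

Definition plaplacian (R : realType) (n : nat) (e : rel 'I_n) (p : R)
    (x : 'rV[R]_n) (i : 'I_n) : R :=
  \sum_(j < n | e i j) phi p (x 0 i - x 0 j).

Definition Sgn (R : realType) (t : R) : set R :=
  if 0 < t then [set 1] else if t < 0 then [set -1] else `[-1, 1]%classic.

Definition plap_eigenvalue_gt1 (R : realType) (n : nat) (e : rel 'I_n)
    (p lam : R) : Prop :=
  exists x : 'rV[R]_n, x != 0 /\
    forall i, plaplacian e p x i = lam * (degree e i)%:R * phi p (x 0 i).

Definition plap_eigenvalue_1 (R : realType) (n : nat) (e : rel 'I_n)
    (lam : R) : Prop :=
  exists (x : 'rV[R]_n) (z : 'I_n -> 'I_n -> R),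
    [/\ x != 0,
        forall i j, e i j -> Sgn (x 0 i - x 0 j) (z i j) /\ z i j = - z j i &
        forall i, [set lam * (degree e i)%:R * s | s in Sgn (x 0 i)]
                    (\sum_(j < n | e i j) z i j)].

(* Only meaningful for 1 <= p. *)
Definition plap_eigenvalue (R : realType) (n : nat) (e : rel 'I_n)
    (p lam : R) : Prop :=
  if p == 1 then plap_eigenvalue_1 e lam else plap_eigenvalue_gt1 e p lam.

Definition rayleigh (R : realType) (n : nat) (e : rel 'I_n) (p : R)
    (x : 'rV[R]_n) : R :=
  (\sum_(i < n) \sum_(j < n | (i < j)%N && e i j) `|x 0 i - x 0 j| `^ p) /
  (\sum_(i < n) (degree e i)%:R * `|x 0 i| `^ p).

(* The unit sphere S^{k-1} of R^k. The Euclidean norm is spelled out because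
   the library's norm on matrices is the sup norm. *)
Definition sphere (R : realType) (k : nat) : set 'rV[R]_k :=
  [set x | \sum_(i < k) x 0 i ^+ 2 = 1].

Definition symmetric_set (R : realType) (n : nat) (S : set 'rV[R]_n) : Prop :=
  [set - x | x in S] = S.

Definition odd_continuous_map (R : realType) (m n : nat)
    (A : set 'rV[R]_m) (B : set 'rV[R]_n) (f : 'rV[R]_m -> 'rV[R]_n) : Prop :=
  [/\ {within A, continuous f}, forall x, A x -> B (f x) &
      forall x, A x -> f (- x) = - f x].

(* Indices take values in \bar R, so that "least" and "largest" are an infimum
   and a supremum of natural numbers, with inf set0 = +oo and with +oo as the
   supremum of an unbounded set. *)
Definition guarded_index (R : realType) (n : nat)
    (idx : set 'rV[R]_n -> \bar R) (S : set 'rV[R]_n) : \bar R :=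
  if `[< S !=set0 /\ symmetric_set S >] then idx S else 0%E.

(* The Krasnoselskii genus. *)
Definition genus_minus (R : realType) (n : nat) : set 'rV[R]_n -> \bar R :=
  guarded_index (fun S => ereal_inf [set k%:R%:E | k in [set k : nat |
    (1 <= k)%N /\ exists f, odd_continuous_map S (@sphere R k) f]]).

Definition genus_plus (R : realType) (n : nat) : set 'rV[R]_n -> \bar R :=
  guarded_index (fun S => ereal_sup [set k%:R%:E | k in [set k : nat |
    (1 <= k)%N /\ exists f, odd_continuous_map (@sphere R k) S f]]).

Definition stdsimplex (R : realType) (q : nat) : set 'rV[R]_q.+1 :=
  [set t | (forall i, 0 <= t 0 i) /\ \sum_i t 0 i = 1].

(* Singular q-simplices of R^n; stdsimplex R q, as a type, carries the subspace
   topology. *)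
Definition singular_simplex (R : realType) (n q : nat) : choiceType :=
  continuousType (@stdsimplex R q) 'rV[R]_n.

Definition chain (R : realType) (n q : nat) : lmodType 'F_2 :=
  {freeg (singular_simplex R n q) / 'F_2}.

Definition face_row (R : realType) (q : nat) (i : 'I_q.+2) (t : 'rV[R]_q.+1) :
    'rV[R]_q.+2 :=
  \row_j (if unlift i j is Some k then t 0 k else 0).

Lemma face_row_stdsimplex (R : realType) (q : nat) (i : 'I_q.+2)
    (t : 'rV[R]_q.+1) : stdsimplex t -> stdsimplex (face_row i t).
Proof.
move=> [t_ge0 t_sum1]; split => [j|].
  by rewrite mxE; case: unliftP.
rewrite (bigD1_ord i) //= mxE unlift_none add0r -t_sum1.
by apply: eq_bigr => k _; rewrite mxE liftK.
Qed.

Definition face (R : realType) (q : nat) (i : 'I_q.+2)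
    (t : @stdsimplex R q) : @stdsimplex R q.+1 :=
  SigSub (mem_set (face_row_stdsimplex i (set_valP t))).

Lemma row_continuous (T : topologicalType) (R : realType) (n : nat)
    (f : T -> 'rV[R]_n) :
  (forall j, continuous (fun t => f t 0 j)) -> continuous f.
Proof.
move=> cf t A [P Pft PA].
have : \forall s \near t, forall j, P 0 j (f s 0 j).
  by apply: filter_forall => j; exact: (cf j t (P 0 j) (Pft 0 j)).
by apply: filterS => s Ps; apply: PA => i j; rewrite (ord1 i).
Qed.

Lemma face_continuous (R : realType) (q : nat) (i : 'I_q.+2) :
  continuous (@face R q i).
Proof.
apply: continuous_comp_initial; apply: row_continuous => j.
case: (unliftP i j) => [k|] ->.
  have -> : (fun t => (set_val \o face i) t 0 (lift i k)) =
            (fun t : @stdsimplex R q => set_val t 0 k).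
    by apply/funext => t /=; rewrite set_valE /= mxE liftK.
  have cval : continuous (set_val : @stdsimplex R q -> 'rV[R]_q.+1).
    exact: initial_continuous.
  by move=> t; exact: (continuous_comp (cval t)
                         (@coord_continuous R 1 q.+1 0 k (set_val t))).
have -> : (fun t => (set_val \o face i) t 0 i) =
          (fun=> 0 : R).
  by apply/funext => t /=; rewrite set_valE /= mxE unlift_none.
exact: cst_continuous.
Qed.

HB.instance Definition _ (R : realType) (q : nat) (i : 'I_q.+2) :=
  isContinuous.Build _ _ (@face R q i) (@face_continuous R q i).

Definition antipode (R : realType) (n : nat) (x : 'rV[R]_n) : 'rV[R]_n := - x.

Lemma antipode_continuous (R : realType) (n : nat) : continuous (@antipode R n).
Proof.
apply: row_continuous => j.
have -> : (fun t => antipode t 0 j) = (fun t : 'rV[R]_n => - t 0 j).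
  by apply/funext => t; rewrite mxE.
move=> t; apply: (continuous_comp (@coord_continuous R 1 n 0 j t)).
exact: opp_continuous.
Qed.

HB.instance Definition _ (R : realType) (n : nat) :=
  isContinuous.Build _ _ (@antipode R n) (@antipode_continuous R n).

Definition boundary (R : realType) (n q : nat) :
    chain R n q.+1 -> chain R n q :=
  fglift (fun s : singular_simplex R n q.+1 =>
    \sum_(i < q.+2) << (s \o @face R q i : singular_simplex R n q) >>
      : chain R n q).

(* The chain map T induced by x |-> - x. *)
Definition chain_opp (R : realType) (n q : nat) : chain R n q -> chain R n q :=
  fglift (fun s : singular_simplex R n q =>
    << (@antipode R n \o s : singular_simplex R n q) >> : chain R n q).

Definition In0 (R : realType) (n : nat) : chain R n 0 -> 'F_2 :=
  fglift (fun _ : singular_simplex R n 0 => 1 : ('F_2)^o).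

(* C_q(S) is identified with the chains of R^n all of whose simplices lie in S. *)
Definition chain_in (R : realType) (n : nat) (S : set 'rV[R]_n) (q : nat) :
    set (chain R n q) :=
  [set c | forall s : singular_simplex R n q, s \in dom c -> forall t, S (s t)].

(* C_q(S,-). *)
Definition sym_chain (R : realType) (n : nat) (S : set 'rV[R]_n) (q : nat) :
    set (chain R n q) :=
  [set c | chain_in S c /\ chain_opp c = c].

Definition is_cycle (R : realType) (n q : nat) : chain R n q -> Prop :=
  match q with
  | 0 => fun=> True
  | _.+1 => fun z => boundary z = 0
  end.

(* Z_q(S,-). *)
Definition sym_cycle (R : realType) (n : nat) (S : set 'rV[R]_n) (q : nat) :
    set (chain R n q) :=
  [set z | sym_chain S z /\ is_cycle z].

(* H_q(S,-), as the set of cosets of the symmetric boundaries. *)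
Definition sym_homology (R : realType) (n : nat) (S : set 'rV[R]_n) (q : nat) :
    set (set (chain R n q)) :=
  [set [set z + boundary b | b in sym_chain S (q := q.+1)] | z in sym_cycle S (q := q)].

(* Some c in C_q(S) with z = c + T c. For z in Z_q(S,-) and 0 \notin S the value of
   nu below does not depend on the choice of c. *)
Definition half (R : realType) (n : nat) (S : set 'rV[R]_n) (q : nat)
    (z : chain R n q) : chain R n q :=
  xget 0 [set c | chain_in S c /\ z = c + chain_opp c].

Fixpoint nu (R : realType) (n : nat) (S : set 'rV[R]_n) (q : nat) :
    chain R n q -> 'F_2 :=
  match q with
  | 0 => fun z => In0 (half S z)
  | _.+1 => fun z => nu S (boundary (half S z))
  end.

(* The map induced by nu on homology: its value on any representative. *)
Definition nu_star (R : realType) (n : nat) (S : set 'rV[R]_n) (q : nat)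
    (a : set (chain R n q)) : 'F_2 :=
  nu S (xget 0 a).

Definition yang_index (R : realType) (n : nat) : set 'rV[R]_n -> \bar R :=
  guarded_index (fun S => ereal_inf [set k%:R%:E | k in [set k : nat |
    (1 <= k)%N /\ forall a, sym_homology S (q := k) a -> nu_star S a = 0]]).

Definition minmax (R : realType) (n : nat) (e : rel 'I_n) (p : R)
    (idx : set 'rV[R]_n -> \bar R) (k : nat) : \bar R :=
  ereal_inf [set ereal_sup [set (rayleigh e p x)%:E | x in S] | S in
    [set S | [/\ compact S, symmetric_set S, ~ S 0 & (k%:R%:E <= idx S)%E]]].

(* Vertices are numbered from 1 here, so i : 'I_6 is the vertex i.+1. *)
Definition edges6 : seq (nat * nat) :=
  [:: (1, 2); (1, 3); (1, 4); (1, 5); (1, 6);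
      (2, 3); (2, 4); (2, 5); (3, 4); (5, 6)]%N.

Definition graph6 : rel 'I_6 :=
  fun i j => ((i.+1, j.+1) \in edges6) || ((j.+1, i.+1) \in edges6).

(* Main.v *)
(* Write F_p = E_p / M_p for the Rayleigh quotient, A = {2,5,6} and B = {1,3,4}.

   Eigenvalue near 5/9. For p = 1 the indicator of A is an eigenvector. Let
   G_p(x) be the maximum over c of E_p(x) / M_p(x - c); modulo scaling and
   constants the indicator of A is a strict local minimum of G_1, with value
   5/9, although it is a saddle of F_1. Hence for p > 1 close to 1 the function
   G_p, which is F_p on the hypersurface sum_i d_i |x_i|^(p-2) x_i = 0, has a
   local minimum there with value close to 5/9, and a local minimum of G_p is
   an eigenvector.

   The min-max values avoid 5/9. On the circle spanned by the indicators of
   {2,3,4} and {1,5,6} one has F_p <= (2/5) 2^(p-1), and all three indices of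
   this circle are at least 2; so the values with k <= 2 are below 1/2. If
   sum_i d_i |x_i|^(p-2) x_i = 0 and x_1 = x_2, then F_p(x) >= (3/5) 2^(1-p).
   So a symmetric set S on which F_p is smaller has an odd map to R^2 minus 0,
   namely x -> (sum_i d_i |x_i|^(p-2) x_i, x_2 - x_1), and all three indices
   of S are at most 2; thus the values with k >= 3 exceed 5/9.

   For the Yang index, an odd map from S to the circle provides a function U
   on points and a Z/2-cocycle W on paths (the parity of the number of turns)
   with U(x) + U(-x) = 1 and W + TW = dU. Writing z = c + Tc,
   bd(c) = d + Td, bd(d) = e + Te, this gives
   nu(z) = In(e) = U(bd(d)) = W(d + Td) = W(bd(c)) = 0 in degree 2. *)

From HB Require Import structures.
From mathcomp.multinomials Require Import freeg.
Require Import Defs.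
From mathcomp Require Import all_boot all_order all_algebra.
From mathcomp Require Import all_classical all_reals all_analysis.
From mathcomp Require Import ring lra.

Set Implicit Arguments.
Unset Strict Implicit.
Unset Printing Implicit Defensive.

Import Order.TTheory GRing.Theory Num.Theory numFieldNormedType.Exports.

Local Open Scope classical_set_scope.
Local Open Scope ring_scope.

(** * Power functions *)

Section PowerFunctions.
Variable R : realType.
Implicit Types a b p q s t : R.

(** For s > 0 write s^p = s s^(p-1); then s^(p-1) >= 1 + (p-1) ln s, from exp u >= 1 + u, and s ln s
    >= s - 1, from ln(1/s) <= 1/s - 1. *)
Lemma bernoulli_powR p s : 1 <= p -> 0 <= s -> 1 + p * (s - 1) <= s `^ p.
Proof.
move=> p1; rewrite le_eqVlt => /orP[/eqP<-|s0].
  by rewrite powR0; lra.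
have sp : s `^ p = s * s `^ (p - 1) by rewrite mulr_powRB1 //; lra.
have l1 : 1 + (p - 1) * ln s <= s `^ (p - 1).
  by rewrite /powR gt_eqF // expR_ge1Dx.
have l2 : ln s^-1 <= s^-1 - 1.
  by have := @le_ln1Dx R (s^-1 - 1); rewrite addrCA subrr addr0; apply; rewrite ltrBrDl subrr invr_gt0.
rewrite lnV ?posrE // in l2.
have l3 : s - 1 <= s * ln s.
  have := ler_wpM2l (ltW s0) l2; rewrite mulrBr mulfV ?gt_eqF // mulr1; lra.
rewrite sp; apply: le_trans (ler_wpM2l (ltW s0) l1).
have : (p - 1) * (s - 1) <= (p - 1) * (s * ln s) by apply: ler_wpM2l => //; lra.
lra.
Qed.

Lemma phiN p t : phi p (- t) = - phi p t.
Proof. by rewrite /phi normrN mulrN. Qed.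

Lemma phi0 p : phi p 0 = 0.
Proof. by rewrite /phi mulr0. Qed.

Lemma phi_pos p t : 0 < t -> phi p t = t `^ (p - 1).
Proof.
move=> t0; rewrite /phi gtr0_norm // -{2}(powRr1 (ltW t0)) -powRD.
  by congr (_ `^ _); lra.
by rewrite (gt_eqF t0) implybT.
Qed.

Lemma mulr_phi p t : 0 < p -> t * phi p t = `|t| `^ p.
Proof.
move=> p0; have pos s : 0 < s -> s * phi p s = `|s| `^ p.
  by move=> s0; rewrite phi_pos // gtr0_norm // mulr_powRB1 // ltW.
have [t0|t0|->] := ltgtP t 0; last by rewrite mul0r normr0 powR0 ?gt_eqF.
  by rewrite -normrN -pos ?oppr_gt0 // phiN mulrNN.
exact: pos.
Qed.

Lemma normr_phi p t : t != 0 -> `|phi p t| = `|t| `^ (p - 1).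
Proof.
move=> t0; rewrite /phi normrM ger0_norm ?powR_ge0 // -[X in _ * X]powRr1 // -powRD.
  by congr (_ `^ _); lra.
by rewrite normr_eq0 t0 implybT.
Qed.

(** [p * phi p a] is a subgradient of |t|^p, also at a = 0 and for p = 1; this replaces derivatives
    below. By symmetry a >= 0, and for a > 0 it is Bernoulli's inequality at |b|/a, scaled by
    a^p. *)
Lemma powR_tangent p a b : 1 <= p ->
  `|a| `^ p + p * phi p a * (b - a) <= `|b| `^ p.
Proof.
move=> p1; have p0 : 0 < p by lra.
wlog a0 : a b / 0 <= a.
  move=> h; have [a0|a0] := leP 0 a; first exact: h.
  have := h (- a) (- b); rewrite !normrN phiN => /(_ _) hh.
  apply: le_trans (hh _); lra.
move: a0; rewrite le_eqVlt => /orP[/eqP<-|a0].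
  by rewrite phi0 normr0 powR0 ?gt_eqF // mulr0 mul0r add0r powR_ge0.
have e : b = a * (b / a) by field; rewrite gt_eqF.
have /(bernoulli_powR p1) : 0 <= `|b / a| by [].
rewrite -(ler_pM2l (powR_gt0 p a0)) -powRM ?(ltW a0) //.
rewrite normf_div (gtr0_norm a0) mulrCA mulfV ?gt_eqF // mulr1.
apply: le_trans.
have bb : b - a <= a * (`|b| / a - 1).
  rewrite mulrBr mulr1 mulrCA mulfV ?gt_eqF // mulr1 lerD2r; exact: ler_norm.
have f0 : 0 <= p * a `^ (p - 1) by rewrite mulr_ge0 ?powR_ge0 // ltW.
have := ler_wpM2l f0 bb; rewrite phi_pos // -(mulr_powRB1 (ltW a0) p0); lra.
Qed.

(** The linear terms of the two tangent inequalities at the midpoint cancel. *)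
Lemma powR_convex_norm p a b : 1 <= p ->
  `|a + b| `^ p <= 2 `^ (p - 1) * (`|a| `^ p + `|b| `^ p).
Proof.
move=> p1; pose m := (a + b) / 2.
have ta := powR_tangent m a p1; have tb := powR_tangent m b p1.
have -> : a + b = 2 * m by rewrite /m; field.
rewrite normrM powRM // ger0_norm // -(@mulr_powRB1 _ 2 p) //; last by lra.
rewrite (mulrC 2) -mulrA ler_wpM2l ?powR_ge0 //.
have : a + b = 2 * m by rewrite /m; field.
move: ta tb; set f := p * _; move=> ta tb e.
have : f * (a - m) + f * (b - m) = 0 by rewrite -mulrDr (_ : _ + _ = 0) ?mulr0 //; lra.
lra.
Qed.

(** With [powR_le2], this compares p-th powers with first powers at a cost that vanishes as p tends
    to 1, and so carries estimates for p = 1 over to nearby p. *)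
Lemma powR_geB1 p t : 1 <= p -> 0 <= t -> t - (p - 1) <= t `^ p.
Proof. by move=> p1 t0; apply: le_trans (bernoulli_powR p1 t0); nra. Qed.

Lemma powR_le2 p t : 1 <= p -> 0 <= t -> t <= 2 -> t `^ p <= 2 `^ (p - 1) * t.
Proof.
move=> p1 t0 t2; rewrite -(@mulr_powRB1 _ t p) //; last by lra.
rewrite mulrC ler_wpM2r // ge0_ler_powR ?nnegrE; lra.
Qed.

Lemma powR_norm_continuous r : 0 < r -> continuous (fun t : R => `|t| `^ r).
Proof.
move=> r0 t; have [->|t0] := eqVneq t 0.
  rewrite /continuous_at normr0 powR0 ?gt_eqF //.
  apply/cvgrPdist_lt => e e0.
  have d0 : 0 < e `^ r^-1 by rewrite powR_gt0.
  exists (e `^ r^-1) => //= s; rewrite /ball_ /= sub0r normrN => se.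
  rewrite sub0r normrN ger0_norm ?powR_ge0 //.
  have -> : e = (e `^ r^-1) `^ r by rewrite -powRrM mulVf ?gt_eqF // powRr1 // ltW.
  by rewrite gt0_ltr_powR ?nnegrE ?powR_ge0.
apply: (@continuous_comp _ _ _ (fun t : R => `|t|) (fun t => t `^ r)).
  exact: norm_continuous.
apply: differentiable_continuous; apply/derivable1_diffP.
by apply: derivable_powR; rewrite in_itv/= andbT normr_gt0.
Qed.

Lemma phi_continuous p : 1 < p -> continuous (phi p).
Proof.
move=> p1 t; have [->|t0] := eqVneq t 0.
  rewrite /continuous_at phi0.
  apply/cvgrPdist_lt => e e0.
  have := @powR_norm_continuous (p - 1) _ 0; rewrite subr_gt0 => /(_ p1).
  rewrite /continuous_at normr0 powR0 ?subr_eq0 ?gt_eqF //.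
  move=> /cvgrPdist_lt /(_ _ e0); apply: filterS => s.
  rewrite !sub0r !normrN; have [->|s0] := eqVneq s 0; first by rewrite phi0 normr0.
  by rewrite normr_phi // ger0_norm // powR_ge0.
apply: (@cvgM _ _ (nbhs t) _ (fun s => `|s| `^ (p - 2)) id); last exact: cvg_id.
apply: (@continuous_comp _ _ _ (fun t : R => `|t|) (fun t => t `^ (p - 2))).
  exact: norm_continuous.
apply: differentiable_continuous; apply/derivable1_diffP.
by apply: derivable_powR; rewrite in_itv/= andbT normr_gt0.
Qed.

End PowerFunctions.

(** * Lifting angles *)

Section AngleLifting.
Variable R : realType.

Lemma unit_vector_angle (a b : R) : a ^+ 2 + b ^+ 2 = 1 ->
  exists th, a = cos th /\ b = sin th.
Proof.
move=> ab1; have a1 : -1 <= a <= 1 by apply/andP; split; nra.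
have sa : Num.sqrt (1 - a ^+ 2) = `|b|.
  by rewrite -ab1 addrAC subrr add0r sqrtr_sqr.
have [b0|b0] := leP 0 b.
  by exists (acos a); rewrite acosK // sin_acos // sa ger0_norm.
exists (- acos a); rewrite cosN sinN acosK // sin_acos // sa.
by rewrite ltr0_norm // opprK.
Qed.

(** The scalar product and [s] are the cosine and sine of the turn from a to b; the turn is acute,
    hence equal to [asin s]. *)
Lemma rotation_step (a1 a2 b1 b2 th : R) :
  a1 = cos th -> a2 = sin th -> b1 ^+ 2 + b2 ^+ 2 = 1 ->
  0 < a1 * b1 + a2 * b2 ->
  let s := a1 * b2 - a2 * b1 in
  [/\ -1 < s < 1, b1 = cos (th + asin s) & b2 = sin (th + asin s)].
Proof.
move=> e1 e2 b c0 s.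
have a : a1 ^+ 2 + a2 ^+ 2 = 1 by rewrite e1 e2 cos2Dsin2.
have cs : (a1 * b1 + a2 * b2) ^+ 2 = 1 - s ^+ 2.
  by rewrite -[X in X - _](mulr1 1) -{1}a -b /s; ring.
have s1 : -1 < s < 1 by apply/andP; split; nra.
have s1' : -1 <= s <= 1 by case/andP: s1 => *; rewrite !ltW.
split=> //; rewrite ?cosD ?sinD asinK // cos_asin // -cs sqrtr_sqr gtr0_norm // -e1 -e2.
  rewrite -[b1 in LHS]mul1r -a /s; ring.
rewrite -[b2 in LHS]mul1r -a /s; ring.
Qed.

Lemma uniform_acute_angle (m : nat) (g1 g2 : 'rV[R]_m -> R) (M : R) :
  continuous g1 -> continuous g2 -> (forall t, g1 t ^+ 2 + g2 t ^+ 2 = 1) ->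
  exists2 e : R, 0 < e & forall y z, `|y| <= M -> `|y - z| < e ->
    0 < g1 y * g1 z + g2 y * g2 z.
Proof.
move=> c1 c2 g1g2.
pose K : set 'rV[R]_m := [set y | `|y| <= M].
have Kc : compact K.
  apply: bounded_closed_compact.
    exists M; split; first exact: num_real.
    by move=> x Mx y /= yM; apply: le_trans yM _; apply: ltW.
  apply: (@closed_comp _ _ (fun y : 'rV[R]_m => `|y|) [set r | r <= M]).
    by move=> x _; exact: norm_continuous.
  exact: closed_le.
have /compact_near_coveringP KC := Kc.
(* The tolerance [e], tending to 0 from the right, is the parameter of the covering argument, so one
   value serves the whole compact ball. *)
have := KC R (0 : R)^'+ (fun e y => forall z, `|y - z| < e ->
   0 < g1 y * g1 z + g2 y * g2 z) _ _.
case.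
  move=> x Kx.
  have near_x : \forall p \near (x, x), 0 < g1 p.1 * g1 p.2 + g2 p.1 * g2 p.2.
    have cc : {for (x, x), continuous (fun p : 'rV[R]_m * 'rV[R]_m =>
        g1 p.1 * g1 p.2 + g2 p.1 * g2 p.2)}.
      by apply: continuousD; apply: continuousM;
        apply: continuous_comp; (exact: cvg_fst || exact: cvg_snd || exact: c1 || exact: c2).
    by apply: (cvgr_gt _ cc); rewrite /= -!expr2 g1g2 ltr01.
  case: near_x => -[A B] /= [nA nB] AB.
  have /nbhs_ballP[d /= d0 dAB] : nbhs x (A `&` B) by exact: filterI.
  exists (ball x (d / 2), [set i | i < d / 2]) => /=.
    split; first by apply: nbhsx_ballx; rewrite divr_gt0.
    by apply: nbhs_right_lt; rewrite divr_gt0.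
  move=> -[y i] /= [xy id2] z yz.
  have xz : ball x d z.
    apply: (@ball_split _ _ y) => //; rewrite -ball_normE /=.
    exact: lt_trans yz id2.
  have xy' : ball x d y by apply: le_ball xy; rewrite ler_pdivrMr // ler_peMr ?ltW //; lra.
  by apply: (AB (y, z)); split => /=; [case: (dAB _ xy')|case: (dAB _ xz)].
move=> r r0 rP; exists (r / 2); first by rewrite divr_gt0.
move=> y z yM; apply: (rP (r / 2)) => //; last by rewrite divr_gt0.
by rewrite /ball_ /= sub0r normrN gtr0_norm ?divr_gt0 // ltr_pdivrMr // ltr_pMr //; lra.
Qed.

(* The angle at t is the angle at 0 plus the sum of the small turns made along
   the segment from 0 to t, cut into steps on which g turns by less than pi/2. *)
Lemma angle_lift (m : nat) (g1 g2 : 'rV[R]_m -> R) (M : R) :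
  0 < M ->
  continuous g1 -> continuous g2 -> (forall t, g1 t ^+ 2 + g2 t ^+ 2 = 1) ->
  exists th : 'rV[R]_m -> R, forall t, `|t| < M ->
    [/\ {for t, continuous th}, g1 t = cos (th t) & g2 t = sin (th t)].
Proof.
move=> M0 c1 c2 g1g2.
have [e e0 eP] := uniform_acute_angle M c1 c2 g1g2.
have [N Ne] : exists N : nat, M < N.+1%:R * e.
  exists (Num.truncn (M / e)); rewrite -ltr_pdivrMr //; exact: truncnS_gt.
have N0 : 0 < N.+1%:R :> R by rewrite ltr0n.
pose h k (t : 'rV[R]_m) := (k%:R / N.+1%:R) *: t.
have hc k : continuous (h k) by move=> t; exact: scaler_continuous.
have : forall k, (k <= N.+1)%N -> exists th : 'rV[R]_m -> R, forall t, `|t| < M ->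
    [/\ {for t, continuous th}, g1 (h k t) = cos (th t) & g2 (h k t) = sin (th t)].
  elim=> [_|k IH kN].
    have [th0 [e1 e2]] := unit_vector_angle (g1g2 0).
    exists (fun=> th0) => t tM; rewrite /h mul0r scale0r.
    by split => //; exact: cst_continuous.
  have [th thP] := IH (ltnW kN).
  pose s t := g1 (h k t) * g2 (h k.+1 t) - g2 (h k t) * g1 (h k.+1 t).
  exists (fun t => th t + asin (s t)) => t tM.
  have [tc t1 t2] := thP _ tM.
  have hk : `|h k t| <= M.
    rewrite normrZ ger0_norm ?divr_ge0 ?ler0n //.
    rewrite -[M]mul1r; apply: ler_pM => //; last exact: ltW.
    by rewrite ler_pdivrMr // mul1r ler_nat ltnW.
  have hkS : `|h k t - h k.+1 t| < e.
    rewrite distrC -scalerBl -mulrBl -natr1 addrAC subrr add0r mul1r.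
    rewrite normrZ ger0_norm ?invr_ge0 ?ler0n // mulrC ltr_pdivrMr // mulrC.
    exact: lt_trans tM Ne.
  have [s1 r1 r2] := rotation_step t1 t2 (g1g2 (h k.+1 t)) (eP _ _ hk hkS).
  split => //; apply: continuousD => //.
  apply: (@continuous_comp _ _ _ s); last exact: continuous_asin.
  have gc g j : continuous g -> {for t, continuous (fun u => g (h j u) : R)}.
    move=> cg; apply: continuous_comp; [exact: hc|exact: cg].
  by apply: continuousB; apply: continuousM; exact: gc.
move=> /(_ N.+1 (leqnn _)) [th thP]; exists th => t /thP.
by rewrite /h mulfV ?gt_eqF // scale1r.
Qed.

End AngleLifting.

(** * The Borsuk-Ulam theorem for maps to the circle *)

Section BorsukUlam.
Variable R : realType.

Lemma within_comp (T U W : topologicalType) (A : set U) (f : U -> W) (r : T -> U) :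
  {within A, continuous f} -> continuous r -> (forall t, A (r t)) ->
  continuous (f \o r).
Proof.
move=> /subspace_continuousP fA rc rA t B Bf.
have fB : nbhs (r t) (fun y => A y -> B (f y)) := fA _ (rA t) _ Bf.
have : nbhs t (fun s => A (r s) -> B (f (r s))) := rc t _ fB.
by apply: (@filterS T (nbhs t)) => s /=; apply.
Qed.

Lemma rV_norm_lt (n : nat) (x : 'rV[R]_n) (e : R) :
  0 < e -> (forall i, `|x 0 i| < e) -> `|x| < e.
Proof.
move=> e0 xe; rewrite [`|x|]mx_normrE; apply/bigmax_ltP; split => // -[i j] _ /=.
by rewrite (ord1 i).
Qed.

Lemma entry_continuous (T : topologicalType) (n : nat) (r : T -> 'rV[R]_n) i :
  continuous r -> continuous (fun t => r t 0 i).
Proof.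
move=> rc t; apply: (@continuous_comp _ _ _ r (fun x : 'rV[R]_n => x 0 i)).
  exact: rc.
exact: coord_continuous.
Qed.

Lemma sphere_entry (n : nat) (x : 'rV[R]_n) i : sphere x -> `|x 0 i| <= 1.
Proof.
rewrite /sphere /= (bigD1 i) //= => x1.
rewrite -(@expr_le1 _ 2) // real_normK ?num_real // -x1 lerDl.
by apply: sumr_ge0 => j _; exact: sqr_ge0.
Qed.

Lemma sphere2E (x : 'rV[R]_2) : sphere x = (x 0 0 ^+ 2 + x 0 1 ^+ 2 = 1).
Proof.
rewrite /sphere /= !big_ord_recl big_ord0 addr0.
by rewrite (_ : lift ord0 ord0 = 1) //; exact: val_inj.
Qed.

Definition circle_point (phi : R) : 'rV[R]_2 :=
  \row_i (if i == 0 then cos phi else sin phi).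

Lemma circle_point0 phi : circle_point phi 0 0 = cos phi.
Proof. by rewrite mxE eqxx. Qed.

Lemma circle_point1 phi : circle_point phi 0 1 = sin phi.
Proof. by rewrite mxE. Qed.

Lemma circle_point_sphere phi : sphere (circle_point phi).
Proof. by rewrite sphere2E circle_point0 circle_point1 cos2Dsin2. Qed.

Lemma circle_point_continuous : continuous circle_point.
Proof.
apply: row_continuous => j; have [->|j0] := eqVneq j 0.
  by rewrite (_ : (fun _ => _) = @cos R); [exact: continuous_cos|apply/funext => t; rewrite circle_point0].
rewrite (_ : (fun _ => _) = @sin R); first exact: continuous_sin.
by apply/funext => t; rewrite mxE (negbTE j0).
Qed.

Lemma circle_pointDpi phi : circle_point (phi + pi) = - circle_point phi.
Proof. by apply/rowP => j; rewrite !mxE cosDpi sinDpi; case: ifP. Qed.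

Lemma circle_point2pi : circle_point (pi + pi) = circle_point 0.
Proof. by rewrite circle_pointDpi -{1}[pi]add0r circle_pointDpi opprK. Qed.

Lemma eq_circle_point (x : 'rV[R]_2) phi :
  x 0 0 = cos phi -> x 0 1 = sin phi -> x = circle_point phi.
Proof.
move=> e0 e1; apply/rowP => j; rewrite mxE; case: eqVneq => [->//|j0].
by rewrite -e1; congr (x 0 _); apply: val_inj; case: j j0 => [[|[|]]].
Qed.

Lemma sphere2_circle_point (x : 'rV[R]_2) : sphere x -> exists phi, x = circle_point phi.
Proof.
rewrite sphere2E => /unit_vector_angle[phi [e0 e1]]; exists phi.
exact: eq_circle_point.
Qed.

(** The increment under the antipode takes opposite values at the angles 0 and pi, so it vanishes in
    between. *)
Lemma circle_antipodal_value (th : 'rV[R]_2 -> R) :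
  continuous (th \o circle_point) ->
  exists phi, th (- circle_point phi) = th (circle_point phi).
Proof.
move=> thc; pose h phi := th (circle_point (phi + pi)) - th (circle_point phi).
have hc : continuous h.
  move=> phi; apply: continuousB; last exact: thc.
  apply: (@continuous_comp _ _ _ (fun x => x + pi) (th \o circle_point)); last exact: thc.
  by apply: continuousD; [exact: cvg_id|exact: cst_continuous].
have h0 : h pi = - h 0 by rewrite /h circle_point2pi add0r opprB.
have [||phi _ hphi] := @IVT R h 0 pi 0 (pi_ge0 R).
- exact: continuous_subspaceT.
- rewrite h0; have [h1|h1] := leP 0 (h 0).
    by rewrite ge_min le_max h1 oppr_le0 h1 orbT.
  by rewrite ge_min le_max (ltW h1) oppr_ge0 (ltW h1) orbT.
by exists phi; apply/eqP; rewrite -subr_eq0 -circle_pointDpi; apply/eqP.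
Qed.

(** On the unit disc this parametrises the upper half of a 2-sphere. Outside, the square root of a
    negative number is 0 and the normalisation projects radially to the equator, which gives a
    continuous map on the whole plane. *)
Definition hemisphere (k : nat) (y : 'rV[R]_2) : 'rV[R]_k.+3 :=
  \row_i (match val i with
          | 0 => y 0 0 | 1 => y 0 1
          | 2 => Num.sqrt (1 - (y 0 0 ^+ 2 + y 0 1 ^+ 2)) | _ => 0 end
          / Num.sqrt (Num.max (y 0 0 ^+ 2 + y 0 1 ^+ 2) 1)).

Lemma hemisphere_sphere k y : sphere (hemisphere k y).
Proof.
rewrite /sphere /= !big_ord_recl !mxE /= big1 ?addr0; last first.
  by move=> i _; rewrite mxE /= mul0r expr0n.
set q := y 0 0 ^+ 2 + y 0 1 ^+ 2; have m0 : 0 < Num.max q 1 by rewrite lt_max ltr01 orbT.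
have e : q + Num.sqrt (1 - q) ^+ 2 = Num.max q 1.
  have [q1|q1] := leP q 1; first by rewrite sqr_sqrtr ?subr_ge0 // addrC subrK.
  by rewrite ler0_sqrtr ?subr_le0 ?ltW // expr0n addr0.
rewrite !exprMn !exprVn (sqr_sqrtr (ltW m0)) -!mulrDl addrA -/q e mulfV //.
by rewrite gt_eqF.
Qed.

Lemma hemisphere_continuous k : continuous (hemisphere k).
Proof.
have qc : continuous (fun y : 'rV[R]_2 => y 0 0 ^+ 2 + y 0 1 ^+ 2).
  have sqc i : continuous (fun y : 'rV[R]_2 => y 0 i ^+ 2).
    move=> y; apply: (@continuous_comp _ _ _ (fun y : 'rV[R]_2 => y 0 i) (fun t => t ^+ 2)).
      exact: coord_continuous.
    exact: exprn_continuous.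
  move=> y; apply: (@cvgD _ _ _ (nbhs y) _ (fun y : 'rV[R]_2 => y 0 0 ^+ 2) (fun y => y 0 1 ^+ 2)).
    exact: sqc.
  exact: sqc.
pose q (y : 'rV[R]_2) := y 0 0 ^+ 2 + y 0 1 ^+ 2.
have sc (f : 'rV[R]_2 -> R) : continuous f -> continuous (fun y => Num.sqrt (f y)).
  move=> fc y; apply: (@continuous_comp _ _ _ f); first exact: fc.
  exact: sqrt_continuous.
have dc : continuous (fun y => (Num.sqrt (Num.max (q y) 1))^-1).
  move=> y; apply: (@continuousV _ _ (fun y => Num.sqrt (Num.max (q y) 1))).
    by rewrite gt_eqF // sqrtr_gt0 lt_max ltr01 orbT.
  apply: sc => {}y; apply: (@continuous_max _ _ q (fun=> 1)); first exact: qc.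
  exact: cst_continuous.
apply: row_continuous => j.
pose num (y : 'rV[R]_2) := match val j with
  | 0 => y 0 0 | 1 => y 0 1 | 2 => Num.sqrt (1 - q y) | _ => 0 end.
have -> : (fun t => hemisphere k t 0 j) =
    (fun y => num y * (Num.sqrt (Num.max (q y) 1))^-1).
  by apply/funext => y; rewrite mxE.
move=> y; apply: (@continuousM _ _ num); last exact: dc.
rewrite /num; case: (val j) => [|[|[|_]]]; [exact: coord_continuous|exact: coord_continuous| |exact: cst_continuous].
apply: (sc (fun y => 1 - q y)) => {}y; apply: (@cvgB _ R _ (nbhs y) _ (fun=> 1) q); last exact: qc.
exact: cvg_cst.
Qed.

Lemma hemisphereN k y : sphere y -> hemisphere k (- y) = - hemisphere k y.
Proof.
rewrite sphere2E => y1; apply/rowP => j; rewrite !mxE !sqrrN y1 subrr sqrtr0 -mulNr.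
by case: (val j) => [|[|[|_]]]; rewrite ?oppr0.
Qed.

(** Over the disc the angle of [f \o hemisphere k] has a continuous lift. Some antipodal pair of
    boundary points shares its value, so [f] agrees there, while oddness makes the two values
    opposite. *)
Lemma borsuk_ulam2 (k : nat) (f : 'rV[R]_k.+3 -> 'rV[R]_2) :
  ~ odd_continuous_map (@sphere R k.+3) (@sphere R 2) f.
Proof.
move=> [fc fS fodd].
pose g := f \o hemisphere k.
have gc : continuous g.
  by apply: within_comp fc _ _; [exact: hemisphere_continuous|exact: hemisphere_sphere].
have gS y : g y 0 0 ^+ 2 + g y 0 1 ^+ 2 = 1.
  by have := fS _ (hemisphere_sphere k y); rewrite sphere2E.
(* Radius 2 puts the closed unit disc inside the open ball on which the lift is continuous. *)
have [th thP] := @angle_lift R 2 (fun y => g y 0 0) (fun y => g y 0 1) 2 (ltr0Sn R 1)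
  (entry_continuous gc) (entry_continuous gc) gS.
have small (y : 'rV[R]_2) : sphere y -> `|y| < 2.
  move=> y1; apply: rV_norm_lt => // i.
  by apply: le_lt_trans (sphere_entry i y1) _; lra.
have [phi e] : exists phi, th (- circle_point phi) = th (circle_point phi).
  apply: circle_antipodal_value => phi.
  apply: (@continuous_comp _ _ _ circle_point th); first exact: circle_point_continuous.
  by case: (thP _ (small _ (circle_point_sphere phi))).
have [_ c0 s0] := thP _ (small _ (circle_point_sphere phi)).
have := circle_point_sphere (phi + pi).
rewrite circle_pointDpi => /small /thP [_]; rewrite e -c0 -s0.
rewrite /g /= hemisphereN ?fodd; last first.
- exact: circle_point_sphere.
- exact: hemisphere_sphere.
rewrite !mxE; have := gS (circle_point phi); rewrite /g /=; nra.
Qed.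

End BorsukUlam.

(** * Symmetric singular chains *)

Section FreeModulesOverF2.
Variable K : choiceType.
Local Notation chains := {freeg K / 'F_2}.

HB.instance Definition _ (M : lmodType 'F_2) (f : K -> M) :=
  GRing.isZmodMorphism.Build chains M (fglift f) (lift_is_additive f).

Lemma F2_neq0 (a : 'F_2) : a != 0 -> a = 1.
Proof. by case: a => [[|[|m]] a2] // _; apply/val_inj. Qed.

Lemma addF2 (M : lmodType 'F_2) (a : M) : a + a = 0.
Proof. by rewrite -mulr2n -scaler_nat (_ : 2%:R = 0) ?scale0r //; apply/eqP. Qed.

Lemma oppF2 (M : lmodType 'F_2) (a : M) : - a = a.
Proof. by apply/eqP; rewrite eqr_oppLR -subr_eq0 opprK addF2. Qed.

Lemma fglift_gen (M : lmodType 'F_2) (f : K -> M) s : fglift f << s >> = f s.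
Proof. by rewrite liftU scale1r. Qed.

Lemma freegE_F2 (c : chains) : c = \sum_(s <- dom c) << s >>.
Proof.
rewrite -{1}(freeg_sumE c); apply: eq_big_seq => s.
by rewrite mem_dom => /F2_neq0 ->.
Qed.

Lemma fgliftE_F2 (M : lmodType 'F_2) (f : K -> M) (c : chains) :
  fglift f c = \sum_(s <- dom c) f s.
Proof.
by rewrite {1}(freegE_F2 c) raddf_sum; apply: eq_bigr => s _; exact: fglift_gen.
Qed.

End FreeModulesOverF2.

Section Chains.
Variables (R : realType) (n : nat).
Implicit Types (q : nat) (S : set 'rV[R]_n).

HB.instance Definition _ q :=
  GRing.isZmodMorphism.Build _ _ (@boundary R n q) (lift_is_additive _).
HB.instance Definition _ q :=
  GRing.isZmodMorphism.Build _ _ (@chain_opp R n q) (lift_is_additive _).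

Lemma In0E (c : chain R n 0) : In0 c = \sum_(s <- dom c) 1.
Proof. exact: (@fgliftE_F2 _ ('F_2)^o (fun=> 1) c). Qed.

Lemma simplexP q (s t : singular_simplex R n q) : (forall x, s x = t x) -> s = t.
Proof. by move=> e; apply/continuousEP. Qed.

Definition face_of q (s : singular_simplex R n q.+1) (i : 'I_q.+2) :
  singular_simplex R n q := s \o @face R q i.

Definition opp_of q (s : singular_simplex R n q) : singular_simplex R n q :=
  @antipode R n \o s.

Lemma boundary_gen q (s : singular_simplex R n q.+1) :
  boundary << s >> = \sum_(i < q.+2) << face_of s i >>.
Proof. exact: fglift_gen. Qed.

Lemma chain_opp_gen q (s : singular_simplex R n q) :
  chain_opp << s >> = << opp_of s >>.
Proof. exact: fglift_gen. Qed.

Lemma opp_ofK q : involutive (@opp_of q).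
Proof. by move=> s; apply: simplexP => x; rewrite /= /antipode opprK. Qed.

Lemma face_of_opp q (s : singular_simplex R n q.+1) i :
  face_of (opp_of s) i = opp_of (face_of s i).
Proof. exact: simplexP. Qed.

Lemma chain_oppK q : involutive (@chain_opp R n q).
Proof.
move=> c; rewrite (freegE_F2 c) !raddf_sum; apply: eq_bigr => s _.
by rewrite /= !chain_opp_gen opp_ofK.
Qed.

Lemma boundary_opp q (c : chain R n q.+1) :
  boundary (chain_opp c) = chain_opp (boundary c).
Proof.
rewrite (freegE_F2 c) !raddf_sum; apply: eq_bigr => s _.
rewrite /= chain_opp_gen !boundary_gen raddf_sum; apply: eq_bigr => i _.
by rewrite /= chain_opp_gen face_of_opp.
Qed.

Lemma chain_in0 S q : chain_in S (0 : chain R n q).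
Proof. by move=> s; rewrite dom0. Qed.

Lemma chain_inD S q (c d : chain R n q) :
  chain_in S c -> chain_in S d -> chain_in S (c + d).
Proof.
by move=> cS dS s /domD_subset; rewrite mem_cat => /orP[/cS|/dS].
Qed.

Lemma chain_in_gen S q (s : singular_simplex R n q) :
  (forall x, S (s x)) -> chain_in S (<< s >> : chain R n q).
Proof. by move=> sS t; rewrite domU1 inE => /eqP ->. Qed.

Lemma chain_in_sum S q I (r : seq I) (P : pred I) (F : I -> chain R n q) :
  (forall i, P i -> chain_in S (F i)) -> chain_in S (\sum_(i <- r | P i) F i).
Proof.
move=> FS; elim/big_ind: _ => //; [exact: chain_in0|exact: chain_inD].
Qed.

Lemma chain_in_boundary S q (c : chain R n q.+1) : chain_in S c -> chain_in S (boundary c).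
Proof.
move=> cS; rewrite {1}(freegE_F2 c) raddf_sum big_seq; apply: chain_in_sum => s sc.
rewrite /= boundary_gen; apply: chain_in_sum => i _; apply: chain_in_gen => x.
exact: cS.
Qed.

Lemma symmetric_setN S x : symmetric_set S -> S x -> S (- x).
Proof. by move=> symS Sx; rewrite -symS; exists x. Qed.

Lemma chain_in_opp S q (c : chain R n q) : symmetric_set S ->
  chain_in S c -> chain_in S (chain_opp c).
Proof.
move=> symS cS; rewrite (freegE_F2 c) raddf_sum big_seq; apply: chain_in_sum => s sc.
rewrite /= chain_opp_gen; apply: chain_in_gen => x; apply: symmetric_setN => //.
exact: cS.
Qed.

Lemma vertex_stdsimplex q (i : 'I_q.+1) : stdsimplex (delta_mx 0 i : 'rV[R]_q.+1).
Proof.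
split=> [j|]; first by rewrite mxE eqxx ler0n.
rewrite (bigD1 i) //= mxE !eqxx big1 ?addr0 // => j /negbTE ji.
by rewrite mxE ji andbF.
Qed.

Definition vertex q (i : 'I_q.+1) : @stdsimplex R q :=
  SigSub (mem_set (vertex_stdsimplex i)).

(** At a vertex, a simplex fixed by the antipode would equal its own negative, hence 0. *)
Lemma opp_of_neq S q (s : singular_simplex R n q) : ~ S 0 ->
  (forall x, S (s x)) -> opp_of s != s.
Proof.
move=> S0 sS; apply/eqP => /(congr1 (fun t : singular_simplex R n q => t (vertex ord0))).
rewrite /= /antipode => /eqP; rewrite eq_sym -addr_eq0 => /eqP sv; apply: S0.
suff <- : s (vertex ord0) = 0 by exact: sS.
apply/rowP => j; have := congr1 (fun v : 'rV[R]_n => v 0 j) sv; rewrite !mxE; lra.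
Qed.

Lemma coeff_chain_opp q (c : chain R n q) s :
  coeff (opp_of s) (chain_opp c) = coeff s c.
Proof.
rewrite (freegE_F2 c) !raddf_sum; apply: eq_bigr => t _.
by rewrite /= chain_opp_gen !coeffU (inv_eq (@opp_ofK q)) opp_ofK.
Qed.

(* T acts freely on the simplices avoiding 0, so the support of a symmetric
   chain splits into pairs {s, T s}. *)
Lemma sym_chain_half S q (z : chain R n q) : ~ S 0 -> sym_chain S z ->
  exists c, chain_in S c /\ z = c + chain_opp c.
Proof.
move=> S0; have [m] := ubnP (size (dom z)).
elim: m z => // m IH z zm [zS zT].
have [->|z0] := eqVneq z 0.
  by exists 0; split; [exact: chain_in0|rewrite raddf0 addr0].
have [s sz] : exists s, s \in dom z.
  by move: z0; rewrite -dom_eq0; case: (dom z) => // s r _; exists s; rewrite mem_head.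
have sS := zS _ sz.
have s1 : coeff s z = 1 by apply: F2_neq0; rewrite -mem_dom.
pose z' := z + (<< s >> + << opp_of s >> : chain R n q).
have z'T : chain_opp z' = z'.
  by rewrite /z' !raddfD /= zT !chain_opp_gen opp_ofK (addrC << s >>).
have z'sub t : t \in dom z' -> (t != s) && (t \in dom z).
  have [->|ts] := eqVneq t s.
    rewrite mem_dom /z' !coeffD !coeffU s1 eqxx (negbTE (opp_of_neq S0 sS)).
    by [].

  rewrite /z' => /domD_subset; rewrite mem_cat => /orP[//|] /domD_subset.
  rewrite mem_cat !domU1 !inE (negbTE ts) /= => /eqP ->.
  by rewrite mem_dom -zT coeff_chain_opp s1 oner_eq0.
have [||c [cS z'c]] := IH z'.
- rewrite -ltnS; apply: leq_trans zm.
  have : uniq (s :: dom z').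
    by rewrite /= uniq_dom andbT; apply/negP => /z'sub; rewrite eqxx.
  move=> /uniq_leq_size; apply=> t; rewrite inE => /orP[/eqP->//|].
  by move=> /z'sub /andP[].
- by split => // t /z'sub /andP[_]; exact: zS.
exists (<< s >> + c); split; first by apply: chain_inD => //; exact: chain_in_gen.
rewrite raddfD /= chain_opp_gen addrACA -z'c /z' addrC -addrA.
by rewrite addF2 addr0.
Qed.

Lemma face_vertex q (i : 'I_q.+2) (j : 'I_q.+1) :
  face i (vertex j) = vertex (lift i j).
Proof.
apply: val_inj; apply/rowP => k; rewrite /= !mxE eqxx /=.
case: unliftP => [l ->|->]; first by rewrite mxE eqxx (inj_eq lift_inj).
by rewrite (negbTE (neq_lift _ _)).
Qed.

Lemma vertex_simplex0 (x : @stdsimplex R 0) : x = vertex ord0.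
Proof.
apply: val_inj; apply/rowP => k; rewrite (ord1 k) mxE !eqxx /=.
by have [_] := set_valP x; rewrite big_ord1.
Qed.

Lemma simplex0P (s t : singular_simplex R n 0) :
  s (vertex ord0) = t (vertex ord0) -> s = t.
Proof. by move=> st; apply: simplexP => x; rewrite (vertex_simplex0 x). Qed.

(** A 0-simplex is determined by its point, so the six iterated faces are compared as points and
    cancel in pairs. *)
Lemma boundary_boundary (c : chain R n 2) : boundary (boundary c) = 0.
Proof.
rewrite (freegE_F2 c) !raddf_sum big1 // => s _.
rewrite /= boundary_gen raddf_sum /=.
under eq_bigr do rewrite boundary_gen.
rewrite !big_ord_recl !big_ord0 !addr0.
have fv (i : 'I_3) (j : 'I_2) (k : 'I_3) : lift i (lift j ord0) = k ->
    face_of (face_of s i) j (vertex ord0) = s (vertex k).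
  by move=> <-; rewrite /= !face_vertex.
have e1 : face_of (face_of s ord0) ord0 =
    face_of (face_of s (lift ord0 ord0)) ord0.
  by apply: simplex0P; rewrite !(fv _ _ (lift ord0 (lift ord0 ord0))) //; apply: val_inj.
have e2 : face_of (face_of s ord0) (lift ord0 ord0) =
    face_of (face_of s (lift ord0 (lift ord0 ord0))) ord0.
  by apply: simplex0P; rewrite !(fv _ _ (lift ord0 ord0)) //; apply: val_inj.
have e3 : face_of (face_of s (lift ord0 ord0)) (lift ord0 ord0) =
    face_of (face_of s (lift ord0 (lift ord0 ord0))) (lift ord0 ord0).
  by apply: simplex0P; rewrite !(fv _ _ ord0) //; apply: val_inj.
by rewrite e1 e2 e3 (addrACA << _ >> << face_of _ (lift _ _) >>) addF2 addr0 addF2.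
Qed.

(* W is a cocycle on paths and U trivialises the double cover S -> S/{x, -x}
   over points; the second condition reads W + TW = dU. *)
Definition parity_cocycle S (W : singular_simplex R n 1 -> ('F_2)^o)
    (U : singular_simplex R n 0 -> ('F_2)^o) :=
  [/\ forall t : singular_simplex R n 2, (forall x, S (t x)) ->
        \sum_(i < 3) W (face_of t i) = 0,
      forall s : singular_simplex R n 1, (forall x, S (s x)) ->
        W s + W (opp_of s) = U (face_of s 0) + U (face_of s 1) &
      forall p : singular_simplex R n 0, (forall x, S (p x)) ->
        U p + U (opp_of p) = 1].

(** * Evaluation of [nu] by a parity cocycle *)

Section ParityCocycle.
Variables (S : set 'rV[R]_n).
Variables (W : singular_simplex R n 1 -> ('F_2)^o) (U : singular_simplex R n 0 -> ('F_2)^o).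
Hypothesis WU : parity_cocycle S W U.

Lemma cocycle_boundary (c : chain R n 2) : chain_in S c -> fglift W (boundary c) = 0.
Proof.
case: WU => WB _ _ cS; rewrite (freegE_F2 c) !raddf_sum big_seq big1 // => s sc.
rewrite /= boundary_gen raddf_sum /= -[RHS](WB s); last exact: cS.
by apply: eq_bigr => i _; exact: fglift_gen.
Qed.

Lemma cocycle_double (c : chain R n 1) : chain_in S c ->
  fglift W (c + chain_opp c) = fglift U (boundary c).
Proof.
case: WU => _ WW _ cS; rewrite raddfD /=.
rewrite (freegE_F2 c) !raddf_sum -big_split; apply: eq_big_seq => s sc.
rewrite /= boundary_gen chain_opp_gen raddf_sum !big_ord_recl big_ord0 addr0.
rewrite (_ : lift ord0 ord0 = 1); last exact/val_inj.
rewrite -[LHS]/(fglift W << s >> + fglift W << opp_of s >>).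
rewrite -[RHS]/(fglift U << face_of s 0 >> + fglift U << face_of s 1 >>).
rewrite !fglift_gen; apply: WW; exact: cS.
Qed.

Lemma cocycle_In0 (c : chain R n 0) : chain_in S c ->
  fglift U (c + chain_opp c) = In0 c.
Proof.
case: WU => _ _ UU cS; rewrite raddfD /= In0E.
rewrite {1 2}(freegE_F2 c) !raddf_sum -big_split; apply: eq_big_seq => s sc.
rewrite /= chain_opp_gen -[LHS]/(fglift U << s >> + fglift U << opp_of s >>).
rewrite !fglift_gen; apply: UU; exact: cS.
Qed.

Lemma half_cases q (z : chain R n q) : Defs.half S z = 0 \/
  (chain_in S (Defs.half S z) /\ z = Defs.half S z + chain_opp (Defs.half S z)).
Proof. by rewrite /Defs.half; set X := [set _ | _]; case: (xgetP 0 X) => [c _ [cS e]|]; [right|left]. Qed.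

Lemma In0_half (z : chain R n 0) : Defs.half S z = 0 \/ In0 (Defs.half S z) = fglift U z.
Proof.
case: (half_cases z) => [->|[hS {3}->]]; first by left.
by right; rewrite cocycle_In0.
Qed.

(* An empty choice set makes [half] return 0, which only produces the value 0. *)
Lemma nu2_eq0 (z : chain R n 2) : nu S z = 0.
Proof.
have In00 : In0 (0 : chain R n 0) = 0 by rewrite In0E dom0 big_nil.
rewrite /=; set c := Defs.half S z; set d := Defs.half S (boundary c).
case: (In0_half (boundary d)) => [->//|->].
have [e|[dS e]] : d = 0 \/ chain_in S d /\ boundary c = d + chain_opp d := half_cases _.
  by rewrite e !raddf0.
rewrite -cocycle_double // -e.
have [e0|[cS _]] : c = 0 \/ chain_in S c /\ z = c + chain_opp c := half_cases _.
  by rewrite e0 !raddf0.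
exact: cocycle_boundary.
Qed.

(** With z = c + Tc and bd(c) = e + Te, nu(z) = In(e) = U(bd(c)) = W(z). The value may be nonzero,
    so the halves must really exist; [sym_chain_half] supplies them. *)
Lemma nu1E (z : chain R n 1) : ~ S 0 -> symmetric_set S -> sym_cycle S z ->
  nu S z = fglift W z.
Proof.
move=> S0 symS [zs bz] /=.
have half_ok q (x : chain R n q) : sym_chain S x ->
    chain_in S (Defs.half S x) /\ x = Defs.half S x + chain_opp (Defs.half S x).
  move=> xs; have [c cP] := sym_chain_half S0 xs.
  by rewrite /Defs.half; set X := [set _ | _]; case: (xgetP 0 X) => [//|/(_ c)].
have [cS zE] := half_ok _ _ zs; set c := Defs.half S z in cS zE *.
(* bd(c) + T bd(c) = bd(z) = 0, which over Z/2 says that bd(c) is symmetric. *)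
have bs : sym_chain S (boundary c).
  split; first exact: chain_in_boundary.
  rewrite -boundary_opp; apply/eqP; rewrite -subr_eq0 -raddfB oppF2 addrC.
  by rewrite -zE; apply/eqP.
have [eS bE] := half_ok _ _ bs.
by rewrite -cocycle_In0 // -bE -cocycle_double // -zE.
Qed.

End ParityCocycle.

End Chains.

(** * The parity of the number of turns *)

Section Turns.
Variable R : realType.
Implicit Types (a b x : R) (k : int).

Lemma circle_pointDturn x k : circle_point (x + k%:~R * (pi *+ 2)) = circle_point x.
Proof.
have nat_case (y : R) (m : nat) : circle_point (y + m%:R * (pi *+ 2)) = circle_point y.
  apply/rowP => j; rewrite !mxE mulr_natl.
  by rewrite (periodicn (@cosD2pi R)) (periodicn (@sinD2pi R)).
case: k => m; first exact: nat_case.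
rewrite NegzE mulrNz mulNr -[in RHS](subrK (m.+1%:R * (pi *+ 2)) x).
by rewrite nat_case.
Qed.

Lemma cos_eq1_pi x : 0 <= x <= pi -> cos x = 1 -> x = 0.
Proof. by move=> x0 c1; rewrite -(cosK x0) ?in_itv //= c1 acos1. Qed.

Lemma pi2_gt0 : 0 < pi *+ 2 :> R.
Proof. by rewrite mulrn_wgt0 ?pi_gt0. Qed.

(** The remainder [r] of a - b modulo a full turn has cosine 1. As cos is injective on [0, pi], r =
    0; a remainder above pi would make 2 pi - r vanish. *)
Lemma circle_point_inj a b : circle_point a = circle_point b ->
  exists k, a = b + k%:~R * (pi *+ 2).
Proof.
move=> ab; have p0 := pi2_gt0.
have c1 : cos (a - b) = 1.
  have := congr1 (fun v : 'rV[R]_2 => v 0 0) ab; rewrite !circle_point0 => c.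
  have := congr1 (fun v : 'rV[R]_2 => v 0 1) ab; rewrite !circle_point1 => s.
  by rewrite cosB c s -!expr2 cos2Dsin2.
pose k := Num.floor ((a - b) / (pi *+ 2)); exists k.
pose r := a - b - k%:~R * (pi *+ 2).
suff r0 : r = 0 by move: r0; rewrite /r; lra.
have cr : cos r = 1.
  have := circle_pointDturn r k; rewrite {1}/r subrK.
  by move/(congr1 (fun v : 'rV[R]_2 => v 0 0)); rewrite !circle_point0 c1.
have /andP[k1 k2] := floor_itv ((a - b) / (pi *+ 2)).
rewrite -/k in k1 k2.
have r0 : 0 <= r by rewrite /r subr_ge0 -ler_pdivlMr.
have r2 : r < pi *+ 2.
  by move: k2; rewrite ltr_pdivrMr // intrD mulrDl mul1r /r -ltrBlDl.
have [rp|rp] := leP r pi; first by apply: cos_eq1_pi => //; rewrite r0.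
have : pi *+ 2 - r = 0.
  apply: cos_eq1_pi; first by apply/andP; split; move: rp r2; rewrite mulr2n; lra.
  by rewrite cosB cos2pi sin2pi mul1r mul0r addr0.
move: r2; lra.
Qed.

Lemma addFF (c : 'F_2) : c + c = 0.
Proof. exact: (@addF2 ('F_2)^o). Qed.

Definition turns x : 'F_2 := (Num.floor (x / (pi *+ 2)))%:~R.

Lemma turnsD x k : turns (x + k%:~R * (pi *+ 2)) = turns x + k%:~R.
Proof.
rewrite /turns mulrDl mulfK ?gt_eqF ?pi2_gt0 // floorDrz ?intr_int //.
by rewrite intrKfloor rmorphD.
Qed.

(** This is the parity of floor(x / pi): it tells the half circles [0, pi) and [pi, 2 pi) apart, so
    it depends only on the point at angle [x]. *)
Definition half_turns x : 'F_2 := turns x + turns (x + pi).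

Lemma half_turns_eq a b : circle_point a = circle_point b ->
  half_turns a = half_turns b.
Proof.
move=> /circle_point_inj [k ->]; rewrite /half_turns addrAC !turnsD addrACA.
by rewrite addFF addr0.
Qed.

Lemma half_turnsDpi a : half_turns a + half_turns (a + pi) = 1.
Proof.
have e : turns (a + pi + pi) = turns a + 1.
  have <- : a + 1%:~R * (pi *+ 2) = a + pi + pi by rewrite mul1r mulr2n addrA.
  exact: turnsD.
rewrite /half_turns e (addrC (turns (a + pi))) addrACA addFF addr0.
by rewrite addrA addFF add0r.
Qed.

End Turns.

(** * Retraction of the whole space onto the standard simplex *)

Section Retraction.
Variables (R : realType) (q : nat).
Implicit Types t : 'rV[R]_q.+1.

Definition pos_mass t := \sum_i Num.max (t 0 i) 0.

(** Negative entries become 0; a total below 1 is completed by equal shares, a total above 1 is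
    divided out. Composing with it yields maps on the whole vector space, as [angle_lift]
    requires. *)
Definition retract_row t : 'rV[R]_q.+1 :=
  \row_i ((Num.max (t 0 i) 0 + (Num.max 1 (pos_mass t) - pos_mass t) / q.+1%:R)
          / Num.max 1 (pos_mass t)).

Lemma max1_gt0 t : 0 < Num.max 1 (pos_mass t).
Proof. by rewrite lt_max ltr01. Qed.

Lemma retract_row_stdsimplex t : stdsimplex (retract_row t).
Proof.
split=> [i|]; first rewrite mxE.
  rewrite divr_ge0 ?(ltW (max1_gt0 t)) // addr_ge0 ?le_max ?lexx ?orbT //.
  by rewrite divr_ge0 ?ler0n // subr_ge0 le_max lexx orbT.
under eq_bigr do rewrite mxE.
rewrite -mulr_suml big_split /= sumr_const card_ord -[X in _ + X]mulr_natr.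
rewrite divfK ?pnatr_eq0 //.
by rewrite addrC subrK mulfV // gt_eqF // max1_gt0.
Qed.

Definition retract t : @stdsimplex R q :=
  SigSub (mem_set (retract_row_stdsimplex t)).

Lemma retract_id (x : @stdsimplex R q) : retract (val x) = x.
Proof.
have [x0 x1] := set_valP x.
have e : pos_mass (val x) = 1.
  by rewrite -[RHS]x1; apply: eq_bigr => i _; apply/max_idPl; exact: x0.
apply: val_inj; apply/rowP => i; rewrite /= mxE e maxxx subrr mul0r addr0 divr1.
by apply/max_idPl; exact: x0.
Qed.

Lemma retract_continuous : continuous retract.
Proof.
have mc i : continuous (fun t => Num.max (t 0 i) 0).
  move=> t; apply: (@continuous_max _ _ (fun t => t 0 i) (fun=> 0)).
    exact: coord_continuous.
  exact: cst_continuous.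
have pc : continuous pos_mass.
  rewrite /pos_mass; apply: continuous_big; last by move=> i _; exact: mc.
  exact: add_continuous.
have m1c : continuous (fun t => Num.max 1 (pos_mass t)).
  move=> t; apply: (@continuous_max _ _ (fun=> 1) pos_mass); first exact: cst_continuous.
  exact: pc.
apply: continuous_comp_initial; apply: row_continuous => j.
have -> : (fun t => (set_val \o retract) t 0 j) = (fun t =>
   (Num.max (t 0 j) 0 + (Num.max 1 (pos_mass t) - pos_mass t) / q.+1%:R)
          * (Num.max 1 (pos_mass t))^-1).
  by apply/funext => t; rewrite set_valE /= mxE.
pose num t := Num.max (t 0 j) 0 + (Num.max 1 (pos_mass t) - pos_mass t) / q.+1%:R.
move=> t; apply: (@cvgM _ _ (nbhs t) _ num (fun t => (Num.max 1 (pos_mass t))^-1)); last first.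
  apply: (@cvgV _ _ (nbhs t)); last exact: m1c.
  by rewrite gt_eqF // max1_gt0.
apply: (@cvgD _ _ _ (nbhs t)); first exact: mc.
apply: (@cvgM _ _ (nbhs t)); last exact: cvg_cst.
by apply: (@cvgB _ _ _ (nbhs t)); [exact: m1c|exact: pc].
Qed.

End Retraction.

(** * Lifted angles on singular simplices and the cocycle of an odd map *)

Section AngleOfSimplices.
Variables (R : realType) (n : nat) (S : set 'rV[R]_n) (f : 'rV[R]_n -> 'rV[R]_2).
Hypothesis fP : odd_continuous_map S (@sphere R 2) f.

Lemma simplex_angle_lift q (s : singular_simplex R n q) : (forall x, S (s x)) ->
  exists th : 'rV[R]_q.+1 -> R, forall x : @stdsimplex R q,
    {for val x, continuous th} /\ f (s x) = circle_point (th (val x)).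
Proof.
move=> sS; have [fc fS _] := fP.
pose g := f \o (s \o @retract R q).
have gc : continuous g.
  apply: within_comp fc _ _; last by move=> t; exact: sS.
  move=> t; apply: (@continuous_comp _ _ _ (@retract R q) s); first exact: retract_continuous.
  exact: cts_fun.
have gS t : sphere (g t) by apply: fS; exact: sS.
have [||t|th thP] := @angle_lift R q.+1 (fun y => g y 0 0) (fun y => g y 0 1) 2 (ltr0Sn R 1).
- exact: entry_continuous.
- exact: entry_continuous.
- by have := gS t; rewrite sphere2E.
exists th => x; have [|c e0 e1] := thP (val x).
  have [x0 x1] := set_valP x.
  apply: rV_norm_lt => // i; rewrite ger0_norm; last exact: x0.
  apply: (@le_lt_trans _ _ 1); last by rewrite ltr1n.
  rewrite -[leRHS]x1 (bigD1 i) //= lerDl sumr_ge0 // => j _; exact: x0.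
split=> //; have gx : g (val x) = f (s x) by rewrite /g /= retract_id.
by rewrite -gx; exact: eq_circle_point.
Qed.

Definition path_lift (s : singular_simplex R n 1) (th : R -> R) :=
  (forall t, 0 <= t <= 1 -> {for t, continuous th}) /\
  forall x : @stdsimplex R 1, f (s x) = circle_point (th (val x 0 1)).

Definition segment_row (t : R) : 'rV[R]_2 := \row_i (if i == 0 then 1 - t else t).

Lemma segment_row_continuous : continuous segment_row.
Proof.
apply: row_continuous => j; rewrite (_ : (fun _ => _) = fun t => if j == 0 then 1 - t else t).
  case: (j == 0) => t; last exact: cvg_id.
  by apply: (@cvgB _ _ _ (nbhs t)); [exact: cvg_cst|exact: cvg_id].
by apply/funext => t; rewrite mxE.
Qed.

Lemma segment_row_stdsimplex t : 0 <= t <= 1 -> stdsimplex (segment_row t).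
Proof.
case/andP=> t0 t1; split=> [i|].
  by rewrite mxE; case: ifP => _ //; rewrite subr_ge0.
by rewrite !big_ord_recl big_ord0 !mxE /= addr0 subrK.
Qed.

Definition segment t (t01 : 0 <= t <= 1) : @stdsimplex R 1 :=
  SigSub (mem_set (segment_row_stdsimplex t01)).

Lemma stdsimplex1E (x : @stdsimplex R 1) : val x = segment_row (val x 0 1).
Proof.
have [_] := set_valP x; rewrite !big_ord_recl big_ord0 addr0.
rewrite (_ : lift ord0 ord0 = 1); last exact: val_inj.
move=> x1; apply/rowP => i; rewrite mxE; case: eqP => [->|/eqP i0].
  by rewrite -x1 addrK.
by congr (val x 0 _); apply: val_inj; case: i i0 => [[|[|]]].
Qed.

Lemma turn_gap (k l : int) : k < l ->
  k%:~R * (pi *+ 2) + pi *+ 2 <= l%:~R * (pi *+ 2) :> R.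
Proof.
move=> kl; have : (k + 1)%:~R <= l%:~R :> R by rewrite ler_int lezD1.
move/(ler_wpM2r (ltW (@pi2_gt0 R))); by rewrite intrD mulrDl mul1r.
Qed.

(** At each time two lifts differ by a whole number of turns. If this number were not the same at
    both ends, continuity would force a difference half a turn away from a whole number. *)
Lemma path_lift_unique s th th' : path_lift s th -> path_lift s th' ->
  exists k : int, th 0 = th' 0 + k%:~R * (pi *+ 2) /\ th 1 = th' 1 + k%:~R * (pi *+ 2).
Proof.
move=> [thc thP] [thc' thP'].
have turn t : 0 <= t <= 1 -> exists k : int, th t - th' t = k%:~R * (pi *+ 2).
  move=> t01; have := thP (segment t01); rewrite thP' /= mxE /= => /esym.
  by move=> /circle_point_inj[k ->]; exists k; rewrite addrC addKr.
have [k0 e0] : exists k : int, th 0 - th' 0 = k%:~R * (pi *+ 2) by apply: turn; rewrite lexx ler01.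
have [k1 e1] : exists k : int, th 1 - th' 1 = k%:~R * (pi *+ 2) by apply: turn; rewrite lexx ler01.
suff k01 : k0 = k1.
  exists k0; split; first by rewrite -e0 addrC subrK.
  by rewrite k01 -e1 addrC subrK.
pose D t := th t - th' t.
have Dc : {within `[0, 1], continuous D}.
  apply: continuous_in_subspaceT => t; rewrite inE /= in_itv /= => t01.
  by apply: (@cvgB _ _ _ (nbhs t)); [exact: thc|exact: thc'].
apply/eqP; apply: contraT => k01.
(* [v] lies half a turn from [k0] turns, on the side of [k1], so its cosine is -1. *)
pose v := k0%:~R * (pi *+ 2) + (if k0 < k1 then pi else - pi) : R.
have [t t01 Dt] : exists2 t, t \in `[0, 1] & D t = v.
  apply: IVT => //; rewrite /D e0 e1 /v.
  have [k_lt|k_gt|k_eq] := ltgtP k0 k1; last by rewrite k_eq eqxx in k01.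
    have := turn_gap k_lt; have := pi_gt0 R; rewrite ge_min le_max mulr2n => p1 p2.
    by apply/andP; split; apply/orP; [left|right]; lra.
  have := turn_gap k_gt; have := pi_gt0 R; rewrite ge_min le_max mulr2n => p1 p2.
  by apply/andP; split; apply/orP; [right|left]; lra.
have [k kE] := turn t t01; move: Dt; rewrite /D kE => kv.
have c1 : cos (k%:~R * (pi *+ 2)) = 1 :> R.
  have := circle_pointDturn (0 : R) k; rewrite add0r.
  by move/(congr1 (fun v : 'rV[R]_2 => v 0 0)); rewrite !circle_point0 cos0.
have : cos v = -1.
  have := circle_pointDturn (if k0 < k1 then pi else - pi : R) k0.
  move/(congr1 (fun v : 'rV[R]_2 => v 0 0)); rewrite !circle_point0 addrC -/v => ->.
  by case: ifP => _; rewrite ?cosN cospi.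
by rewrite -kv c1; lra.
Qed.

(** The cochain W. Another lift adds the same integer to both terms, so every lift gives the same
    parity. *)
Definition turn_parity (s : singular_simplex R n 1) : ('F_2)^o :=
  let th := xget (fun=> 0) [set th | path_lift s th] in turns (th 0) + turns (th 1).

Definition half_plane_parity (p : singular_simplex R n 0) : ('F_2)^o :=
  half_turns (xget 0 [set a | f (p (vertex R ord0)) = circle_point a]).

Lemma turn_parityE s th : path_lift s th -> turn_parity s = turns (th 0) + turns (th 1).
Proof.
move=> sth; rewrite /turn_parity; case: xgetP => [th' _ /= sth'|/(_ th)//].
have [k [-> ->]] := path_lift_unique sth' sth.
by rewrite !turnsD addrACA addFF addr0.
Qed.

Lemma half_plane_parityE (p : singular_simplex R n 0) a : f (p (vertex R ord0)) = circle_point a ->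
  half_plane_parity p = half_turns a.
Proof.
move=> pa; apply: half_turns_eq; by case: xgetP => [b _ /= <-|/(_ a)/(_ pa)].
Qed.

Lemma vertex1_val (i : 'I_2) : val (vertex R i) 0 1 = (val i)%:R.
Proof. by rewrite /= mxE eqxx; case: i => [[|[|]]]. Qed.

Lemma half_plane_parity_face s th (i : 'I_2) : path_lift s th ->
  half_plane_parity (face_of s i) = half_turns (th (val (lift i (ord0 : 'I_1)))%:R).
Proof.
by move=> [_ sth]; apply: half_plane_parityE; rewrite /= face_vertex sth vertex1_val.
Qed.

Lemma path_lift_exists (s : singular_simplex R n 1) : (forall x, S (s x)) ->
  exists th, path_lift s th.
Proof.
move=> /simplex_angle_lift[th thP]; exists (th \o segment_row); split=> [t t01|x].
  have [c _] := thP (segment t01).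
  by apply: (@continuous_comp _ _ _ segment_row th) => //; exact: segment_row_continuous.
by have [_ ->] := thP x; rewrite /= -stdsimplex1E.
Qed.

Lemma path_lift_opp (s : singular_simplex R n 1) th : (forall x, S (s x)) ->
  path_lift s th -> path_lift (opp_of s) (fun t => th t + pi).
Proof.
have [_ _ fo] := fP; move=> sS [thc sth]; split=> [t t01|x].
  by apply: (@cvgD _ _ _ (nbhs t)); [exact: thc|exact: cvg_cst].
by rewrite circle_pointDpi -sth /= /antipode fo.
Qed.

(** A lift over a 2-simplex restricts to its three edges, and each vertex is counted twice. Adding
    pi lifts the antipodal path, and [turns] at an angle and at the angle plus pi add up to
    [half_turns]. At antipodal points the values of [half_turns] sum to 1. *)
Lemma odd_map_parity_cocycle : parity_cocycle S turn_parity half_plane_parity.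
Proof.
have [_ fS fo] := fP.
split=> [t tS|s sS|p pS].
- have [th thP] := simplex_angle_lift tS.
  have face_lift i : path_lift (face_of t i) (fun u => th (face_row i (segment_row u))).
    split=> [u u01|x]; last first.
      by have [_ /= ->] := thP (face i x); rewrite -stdsimplex1E.
    have [c _] := thP (face i (segment u01)).
    apply: (@continuous_comp _ _ _ (fun u => face_row i (segment_row u)) th) => //.
    apply: row_continuous => j; rewrite (_ : (fun _ => _) =
        fun u => if unlift i j is Some k then segment_row u 0 k else 0).
      by case: unlift => [k|] v; [exact: (entry_continuous segment_row_continuous)|exact: cvg_cst].
    by apply/funext => v; rewrite mxE.
  have row_vertex (j : 'I_2) : segment_row (val j)%:R = val (vertex R j).
    by rewrite [RHS]stdsimplex1E vertex1_val.
  have vertex_row i (j : 'I_2) : face_row i (segment_row (val j)%:R) =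
      val (vertex R (inord (bump i j) : 'I_3)).
    rewrite row_vertex -[LHS]/(val (face i (vertex R j))) face_vertex.
    by congr (val (vertex R _)); apply: val_inj; rewrite /= inordK // -[X in (_ < X)%N]/(2.+1) ltnS; exact: (ltn_ord (lift i j)).
  pose K m := turns (th (val (vertex R (inord m : 'I_3)))).
  have e i : turn_parity (face_of t i) = K (bump i 0) + K (bump i 1).
    rewrite (turn_parityE (face_lift i)).
    by congr (turns (th _) + turns (th _)); [exact: (vertex_row i 0)|exact: (vertex_row i 1)].
  rewrite !big_ord_recl big_ord0 !e addr0 /bump /=.
  have sum6 (a b c : 'F_2) : a + b + (c + b + (c + a)) = 0.
    by rewrite (addrACA c) addFF add0r (addrC b) addFF.
  exact: sum6.
- have [th sth] := path_lift_exists sS.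
  rewrite (turn_parityE sth) (turn_parityE (path_lift_opp sS sth)).
  rewrite !(half_plane_parity_face _ sth) /half_turns /= addrACA addrC.
  by [].
have [a pa] := sphere2_circle_point (fS _ (pS (vertex R ord0))).
rewrite (half_plane_parityE pa) (@half_plane_parityE _ (a + pi)) ?half_turnsDpi //.
by rewrite circle_pointDpi -pa /= /antipode fo.
Qed.

End AngleOfSimplices.

(** * Bounds for the three indices *)

Section IndexBounds.
Variables (R : realType) (n : nat).

Lemma guarded_index_le (idx : set 'rV[R]_n -> \bar R) S (a : \bar R) :
  (0 <= a)%E -> (symmetric_set S -> idx S <= a)%E -> (guarded_index idx S <= a)%E.
Proof. by move=> a0 Sa; rewrite /guarded_index; case: ifPn => // /asboolP[_ /Sa]. Qed.

Lemma guarded_indexE (idx : set 'rV[R]_n -> \bar R) S :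
  S !=set0 -> symmetric_set S -> guarded_index idx S = idx S.
Proof. by move=> S0 Ss; rewrite /guarded_index asboolT. Qed.

Lemma odd_continuous_map_comp (m k : nat) (A : set 'rV[R]_m) (B : set 'rV[R]_n)
    (C : set 'rV[R]_k) g f :
  odd_continuous_map A B g -> odd_continuous_map B C f ->
  odd_continuous_map A C (f \o g).
Proof.
move=> [gc gB go] [fc fC fo]; split=> [|x /gB /fC //|x Ax]; last first.
  by rewrite /= go // fo //; exact: gB.
apply/subspace_continuousP => x Ax D fD.
have /subspace_continuousP /(_ _ (gB _ Ax)) /(_ _ fD) := fc.
move=> fB.
have fB' : nbhs (g x) (fun y => B y -> D (f y)) := fB.
have /subspace_continuousP /(_ _ Ax) /(_ _ fB') := gc => gA.
have gA' : nbhs x (fun y => A y -> B (g y) -> D (f (g y))) := gA.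
by apply: (@filterS _ (nbhs x)) gA' => y h Ay; apply: h => //; exact: gB.
Qed.

(** * Upper bounds from an odd map to the circle *)

Section UpperBounds.
Variables (S : set 'rV[R]_n) (f : 'rV[R]_n -> 'rV[R]_2).
Hypothesis fP : odd_continuous_map S (@sphere R 2) f.

Lemma genus_minus_le2 : (genus_minus S <= 2%:R%:E)%E.
Proof.
apply: guarded_index_le => [|_]; first by rewrite lee_fin.
by apply: ereal_inf_lbound; exists 2%N => //; split => //; exists f.
Qed.

(** An odd map to [S] from a sphere of dimension at least 2, followed by [f], would contradict
    [borsuk_ulam2]. *)
Lemma genus_plus_le2 : (genus_plus S <= 2%:R%:E)%E.
Proof.
apply: guarded_index_le => [|_]; first by rewrite lee_fin.
apply: ge_ereal_sup => _ [k [k1 [g gP]] <-]; rewrite lee_fin ler_nat.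
rewrite leqNgt; apply/negP; case: k k1 g gP => [|[|[|k]]] // _ g gP _.
by apply: (@borsuk_ulam2 R k (f \o g)); exact: odd_continuous_map_comp gP fP.
Qed.

Lemma yang_index_le2 : (yang_index S <= 2%:R%:E)%E.
Proof.
apply: guarded_index_le => [|_]; first by rewrite lee_fin.
apply: ereal_inf_lbound; exists 2%N => //; split => // a _.
exact: nu2_eq0 (odd_map_parity_cocycle fP) _.
Qed.

End UpperBounds.

(** * Lower bounds for an embedded circle *)

Section EmbeddedCircle.
Variables (L : 'rV[R]_2 -> 'rV[R]_n) (P : 'rV[R]_n -> 'rV[R]_2).
Hypotheses (Lc : continuous L) (Pc : continuous P).
Hypotheses (LN : forall x, L (- x) = - L x) (PN : forall x, P (- x) = - P x).
Hypothesis LK : cancel L P.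

Definition embedded_circle : set 'rV[R]_n := [set L x | x in @sphere R 2].
Local Notation S := embedded_circle.

Lemma sphereN k (x : 'rV[R]_k) : sphere x -> sphere (- x).
Proof. by rewrite /sphere /=; under [in X in _ -> X]eq_bigr do rewrite mxE sqrrN. Qed.

Lemma embedded_circle_compact : compact S.
Proof.
apply: continuous_compact; first exact: continuous_subspaceT.
apply: bounded_closed_compact.
  exists 1; split; first exact: num_real.
  move=> M M1 x x1 /=; apply: ltW; apply: rV_norm_lt; first exact: lt_trans M1.
  by move=> i; apply: le_lt_trans M1; exact: sphere_entry.
rewrite (_ : @sphere R 2 = (fun x : 'rV[R]_2 => x 0 0 ^+ 2 + x 0 1 ^+ 2) @^-1` [set 1]).
  apply: closed_comp; last exact: closed_eq.
  move=> x _; apply: (@cvgD _ _ _ (nbhs x)).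
    by apply: (@cvgM _ _ (nbhs x)); exact: coord_continuous.
  by apply: (@cvgM _ _ (nbhs x)); exact: coord_continuous.
by apply/seteqP; split => x; rewrite sphere2E.
Qed.

Lemma embedded_circle_symmetric : symmetric_set S.
Proof.
apply/seteqP; split=> [_ [_ [y y1 <-] <-]|_ [y y1 <-]] /=.
  by exists (- y); [exact: sphereN|rewrite LN].
by exists (L (- y)); [exists (- y) => //; exact: sphereN|rewrite LN opprK].
Qed.

Lemma embedded_circle_neq0 : S !=set0.
Proof. by exists (L (circle_point 0)), (circle_point 0) => //; exact: circle_point_sphere. Qed.

Lemma embedded_circle_not0 : ~ S 0.
Proof.
move=> [x x1 Lx]; have : P 0 = 0.
  by apply/rowP => i; have := congr1 (fun v : 'rV[R]_2 => v 0 i) (PN 0); rewrite oppr0 !mxE; lra.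
by rewrite -Lx LK => x0; move: x1; rewrite sphere2E x0 !mxE; lra.
Qed.

Lemma embedded_circle_param : odd_continuous_map (@sphere R 2) S L.
Proof. by split=> // [|x x1]; [exact: continuous_subspaceT|exists x]. Qed.

Lemma embedded_circle_proj : odd_continuous_map S (@sphere R 2) P.
Proof. by split=> // [|_ [x x1 <-]]; [exact: continuous_subspaceT|rewrite LK]. Qed.

Lemma genus_plus_embedded_circle : (2%:R%:E <= genus_plus S)%E.
Proof.
rewrite /genus_plus guarded_indexE; [|exact: embedded_circle_neq0|exact: embedded_circle_symmetric].
by apply: ereal_sup_ubound; exists 2%N => //; split => //; exists L; exact: embedded_circle_param.
Qed.

(** An odd map to S^0 is an odd scalar function without zeros; by [circle_antipodal_value] it takes
    equal values, hence 0, at some antipodal pair. *)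
Lemma genus_minus_embedded_circle : (2%:R%:E <= genus_minus S)%E.
Proof.
rewrite /genus_minus guarded_indexE; [|exact: embedded_circle_neq0|exact: embedded_circle_symmetric].
apply: le_ereal_inf_tmp => _ [k [k1 [f fP]] <-]; rewrite lee_fin ler_nat.
case: k k1 f fP => [|[|k]] // _ f fP; exfalso.
have [gc gS go] := odd_continuous_map_comp embedded_circle_param fP.
have gcc : continuous ((f \o L) \o @circle_point R).
  by apply: within_comp gc _ _; [exact: circle_point_continuous|exact: circle_point_sphere].
have [phi] := @circle_antipodal_value R (fun x => f (L x) 0 0) (entry_continuous gcc).
have := gS _ (circle_point_sphere phi); have := go _ (circle_point_sphere phi).
rewrite /= => ->; rewrite /sphere /= big_ord1 mxE; set a := f _ _ _ => a1 aN.
have a0 : a = 0 by lra.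
by move: a1; rewrite a0 expr0n /= => /eqP; rewrite eq_sym oner_eq0.
Qed.

(** A path from a point of the circle to its antipode; with its image under T it closes up to the
    fundamental cycle. *)
Definition half_circle_map (x : @stdsimplex R 1) : 'rV[R]_n :=
  L (circle_point (pi * val x 0 1)).

Lemma half_circle_map_continuous : continuous half_circle_map.
Proof.
have vc : continuous (fun x : @stdsimplex R 1 => pi * val x 0 1).
  move=> x; apply: (@cvgM _ _ (nbhs x)); first exact: cvg_cst.
  apply: (@entry_continuous _ _ _ (fun x : @stdsimplex R 1 => val x)).
  exact: initial_continuous.
move=> x; apply: (@continuous_comp _ _ _ (fun x : @stdsimplex R 1 => pi * val x 0 1) (L \o @circle_point R)).
  exact: vc.
apply: continuous_comp; [exact: circle_point_continuous|exact: Lc].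
Qed.

Definition half_circle : singular_simplex R n 1 := mkcts half_circle_map_continuous.

(** Degree 1 must carry a class of nonzero value. For z = c + Tc with c the half circle, nu(z) =
    W(z) = U(bd(c)) = 1, as bd(c) is a pair of antipodal points. *)
Lemma yang_index_embedded_circle : (2%:R%:E <= yang_index S)%E.
Proof.
rewrite /yang_index guarded_indexE; [|exact: embedded_circle_neq0|exact: embedded_circle_symmetric].
apply: le_ereal_inf_tmp => _ [k [k1 kP] <-]; rewrite lee_fin ler_nat.
case: k k1 kP => [|[|k]] // _ kP; exfalso.
have S0 := embedded_circle_not0; have symS := embedded_circle_symmetric.
have WU := odd_map_parity_cocycle embedded_circle_proj.
set W := turn_parity _ in WU; set U := half_plane_parity _ in WU.
pose c := << half_circle >> : chain R n 1.
have hS x : S (half_circle x).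
  by exists (circle_point (pi * val x 0 1)) => //; exact: circle_point_sphere.
have cS : chain_in S c by apply: chain_in_gen.
pose z := c + chain_opp c.
have zS : chain_in S z by apply: chain_inD => //; exact: chain_in_opp.
have zT : chain_opp z = z by rewrite /z raddfD /= chain_oppK addrC.
have ends : opp_of (face_of half_circle 1) = face_of half_circle 0.
  apply: simplex0P; rewrite /= !face_vertex /antipode /half_circle /mkcts /=.
  rewrite /half_circle_map !vertex1_val /=.
  by rewrite mulr0 mulr1 -LN -circle_pointDpi add0r.
have z0 : boundary z = 0.
  rewrite /z raddfD /= boundary_opp boundary_gen !big_ord_recl big_ord0 addr0.
  rewrite (_ : lift ord0 ord0 = 1); last exact: val_inj.
  rewrite raddfD /= !chain_opp_gen -ends opp_ofK (addrC << face_of _ _ >>).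
  by rewrite addF2.
have Wz : fglift W z = 1.
  rewrite (cocycle_double WU) // boundary_gen !big_ord_recl big_ord0 addr0.
  rewrite (_ : lift ord0 ord0 = 1); last exact: val_inj.
  rewrite -ends raddfD /= !fglift_gen addrC.
  case: WU => _ _; apply => x; exact: hS.
pose a : set (chain R n 1) := [set z + boundary b | b in sym_chain S (q := 2)].
(* [nu_star] evaluates a chosen representative z + bd(b) of the class; W vanishes on bd(b). *)
have [b [bS bT] bE] : a (xget 0 a).
  case: xgetP => [x _ //|/(_ z)]; case; exists 0; last by rewrite raddf0 addr0.
  by split; [exact: chain_in0|rewrite raddf0].
have := kP a; rewrite /nu_star -bE (nu1E WU) // => [|]; last first.
  split; last by rewrite /= raddfD /= z0 boundary_boundary addr0.
  split; first by apply: chain_inD => //; exact: chain_in_boundary.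
  by rewrite raddfD /= zT -boundary_opp bT.
rewrite raddfD /= Wz (cocycle_boundary WU) // addr0 => a10.
by have /a10/eqP : sym_homology S a by exists z.
Qed.

End EmbeddedCircle.
End IndexBounds.

(** * The graph *)

Local Notation v1 := (@Ordinal 6 0 isT).
Local Notation v2 := (@Ordinal 6 1 isT).
Local Notation v3 := (@Ordinal 6 2 isT).
Local Notation v4 := (@Ordinal 6 3 isT).
Local Notation v5 := (@Ordinal 6 4 isT).
Local Notation v6 := (@Ordinal 6 5 isT).

Lemma sum_vertices (V : nmodType) (F : 'I_6 -> V) :
  \sum_i F i = F v1 + (F v2 + (F v3 + (F v4 + (F v5 + F v6)))).
Proof.
rewrite !big_ord_recl big_ord0 addr0.
by do !congr (_ + _); congr F; apply: val_inj.
Qed.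

Lemma vertex_ind (P : 'I_6 -> Prop) :
  P v1 -> P v2 -> P v3 -> P v4 -> P v5 -> P v6 -> forall i, P i.
Proof.
move=> P1 P2 P3 P4 P5 P6 [[|[|[|[|[|[|i]]]]]] //= i6];
  by rewrite (bool_irrelevance i6 isT).
Qed.

Lemma degree_graph6 : [/\ degree graph6 v1 = 5%N, degree graph6 v2 = 4%N,
  degree graph6 v3 = 3%N, degree graph6 v4 = 3%N &
  degree graph6 v5 = 3%N /\ degree graph6 v6 = 2%N].
Proof.
have deg i : degree graph6 i = \sum_j (if graph6 i j then 1 else 0)%N.
  by rewrite /degree cardsE -sum1_card big_mkcond.
by rewrite !deg !sum_vertices.
Qed.

Section Graph6.
Variable R : realType.
Implicit Types (p a b c t lam : R) (x y z : 'rV[R]_6).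

Definition energy p x : R :=
  `|x 0 v1 - x 0 v2| `^ p + `|x 0 v1 - x 0 v3| `^ p + `|x 0 v1 - x 0 v4| `^ p +
  `|x 0 v1 - x 0 v5| `^ p + `|x 0 v1 - x 0 v6| `^ p + `|x 0 v2 - x 0 v3| `^ p +
  `|x 0 v2 - x 0 v4| `^ p + `|x 0 v2 - x 0 v5| `^ p + `|x 0 v3 - x 0 v4| `^ p +
  `|x 0 v5 - x 0 v6| `^ p.

Definition weighted_sum (F : R -> R) x : R :=
  5 * F (x 0 v1) + 4 * F (x 0 v2) + 3 * F (x 0 v3) + 3 * F (x 0 v4) +
  3 * F (x 0 v5) + 2 * F (x 0 v6).

Definition mass p x : R := weighted_sum (fun t => `|t| `^ p) x.

(** For p > 1 this is, up to the factor -p, the derivative at c = 0 of the mass of x - c. *)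
Definition moment p x : R := weighted_sum (phi p) x.

Lemma rayleighE p x : rayleigh graph6 p x = energy p x / mass p x.
Proof.
rewrite /rayleigh; congr (_ / _).
  under eq_bigr do rewrite big_mkcond.
  by rewrite !sum_vertices /= /energy !(addr0, add0r, addrA).
have [d1 d2 d3 d4 [d5 d6]] := degree_graph6.
by rewrite !sum_vertices d1 d2 d3 d4 d5 d6 /mass /weighted_sum !addrA.
Qed.

Lemma plaplacianE p x :
  [/\ plaplacian graph6 p x v1 = phi p (x 0 v1 - x 0 v2) + phi p (x 0 v1 - x 0 v3) +
        phi p (x 0 v1 - x 0 v4) + phi p (x 0 v1 - x 0 v5) + phi p (x 0 v1 - x 0 v6),
      plaplacian graph6 p x v2 = - phi p (x 0 v1 - x 0 v2) + phi p (x 0 v2 - x 0 v3) +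
        phi p (x 0 v2 - x 0 v4) + phi p (x 0 v2 - x 0 v5),
      plaplacian graph6 p x v3 = - phi p (x 0 v1 - x 0 v3) - phi p (x 0 v2 - x 0 v3) +
        phi p (x 0 v3 - x 0 v4),
      plaplacian graph6 p x v4 = - phi p (x 0 v1 - x 0 v4) - phi p (x 0 v2 - x 0 v4)
        - phi p (x 0 v3 - x 0 v4) &
      plaplacian graph6 p x v5 = - phi p (x 0 v1 - x 0 v5) - phi p (x 0 v2 - x 0 v5) +
        phi p (x 0 v5 - x 0 v6) /\
      plaplacian graph6 p x v6 = - phi p (x 0 v1 - x 0 v6) - phi p (x 0 v5 - x 0 v6)].
Proof.
have lapE i : plaplacian graph6 p x i =
    \sum_j (if graph6 i j then phi p (x 0 i - x 0 j) else 0).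
  by rewrite /plaplacian big_mkcond.
by rewrite !lapE !sum_vertices /= -!phiN !opprB; split; [| | | |split];
  rewrite !(addr0, add0r, addrA).
Qed.

Lemma mass_gt0 p x : x != 0 -> 0 < mass p x.
Proof.
move=> x0; have [i xi0] : exists i, x 0 i != 0.
  apply: contrapT => /forallNP h; move/eqP: x0; apply; apply/rowP => i.
  by rewrite mxE; apply/eqP; have /negP := h i; rewrite negbK.
have := @powR_gt0 _ `|x 0 i| p; rewrite normr_gt0 xi0 => /(_ isT).
rewrite /mass /weighted_sum.
have h j : 0 <= `|x 0 j| `^ p by exact: powR_ge0.
have h1 := h v1; have h2 := h v2; have h3 := h v3; have h4 := h v4.
have h5 := h v5; have h6 := h v6.
by move: i {xi0}; apply: vertex_ind => hi; lra.
Qed.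

Lemma energy_tangent p x y : 1 <= p ->
  energy p y + p * (\sum_i plaplacian graph6 p y i * (x 0 i - y 0 i)) <= energy p x.
Proof.
move=> p1; have [l1 l2 l3 l4 [l5 l6]] := plaplacianE p y.
rewrite sum_vertices l1 l2 l3 l4 l5 l6 /energy.
have T i j := powR_tangent (y 0 i - y 0 j) (x 0 i - x 0 j) p1.
have := T v1 v2; have := T v1 v3; have := T v1 v4; have := T v1 v5; have := T v1 v6.
have := T v2 v3; have := T v2 v4; have := T v2 v5; have := T v3 v4; have := T v5 v6.
lra.
Qed.

Lemma mass_tangent p x y : 1 <= p ->
  mass p y + p * weighted_sum id (\row_i (phi p (y 0 i) * (x 0 i - y 0 i))) <= mass p x.
Proof.
move=> p1; rewrite /mass /weighted_sum !mxE.
have T i := powR_tangent (y 0 i) (x 0 i) p1.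
have := T v1; have := T v2; have := T v3; have := T v4; have := T v5; have := T v6.
lra.
Qed.

End Graph6.

(** * Bounds for the min-max values *)

Section MinmaxBounds.
Variable R : realType.
Implicit Types (p c t : R) (x y : 'rV[R]_6).

(** For t > 0, Bernoulli's inequality with exponent 1/t at 1 + t gives 2 <= (1 + t)^(1/t). *)
Lemma powR2_le_linear t : 0 <= t <= 1 -> 2 `^ t <= 1 + t.
Proof.
case/andP; rewrite le_eqVlt => /orP[/eqP<-|t0 t1]; first by rewrite powRr0 addr0.
have : 2 <= (1 + t) `^ t^-1.
  apply: le_trans (bernoulli_powR _ _); rewrite ?invf_ge1 //; last by lra.
  by rewrite addrAC subrr add0r mulVf ?gt_eqF.
move/(@ge0_ler_powR R t (ltW t0) 2 _); rewrite !nnegrE => /(_ _ _) h.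
have := h _ _; rewrite -powRrM mulVf ?gt_eqF // powRr1; last by lra.
by apply; rewrite // powR_ge0.
Qed.

(* Spanned by the indicators of {2,3,4} and {1,5,6}. *)
Definition plane_embedding (y : 'rV[R]_2) : 'rV[R]_6 :=
  \row_i (if val i \in [:: 1; 2; 3]%N then y 0 0 else y 0 1).

Definition plane_projection (x : 'rV[R]_6) : 'rV[R]_2 :=
  \row_i (if i == 0 then x 0 v2 else x 0 v1).

Lemma plane_embedding_continuous : continuous plane_embedding.
Proof.
apply: row_continuous => j; rewrite (_ : (fun _ => _) =
    fun y : 'rV[R]_2 => y 0 (if val j \in [:: 1; 2; 3]%N then 0 else 1)).
  exact: coord_continuous.
by apply/funext => y; rewrite mxE; case: ifP.
Qed.

Lemma plane_projection_continuous : continuous plane_projection.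
Proof.
apply: row_continuous => j; rewrite (_ : (fun _ => _) =
    fun y : 'rV[R]_6 => y 0 (if j == 0 then v2 else v1)).
  exact: coord_continuous.
by apply/funext => y; rewrite mxE; case: ifP.
Qed.

Lemma plane_embeddingN (y : 'rV[R]_2) : plane_embedding (- y) = - plane_embedding y.
Proof. by apply/rowP => j; rewrite !mxE; case: ifP. Qed.

Lemma plane_projectionN x : plane_projection (- x) = - plane_projection x.
Proof. by apply/rowP => j; rewrite !mxE; case: ifP. Qed.

Lemma plane_embeddingK : cancel plane_embedding plane_projection.
Proof.
move=> y; apply/rowP => j; rewrite !mxE /=; case: eqP => [->//|/eqP j0].
by congr (y 0 _); apply: val_inj; case: j j0 => [[|[|]]].
Qed.

(** Four edges join {2,3,4} to {1,5,6}, and the degrees on either side add up to 10. *)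
Lemma rayleigh_plane p (y : 'rV[R]_2) : 1 <= p -> plane_embedding y != 0 ->
  rayleigh graph6 p (plane_embedding y) <= 2 / 5 * 2 `^ (p - 1).
Proof.
move=> p1 y0; rewrite rayleighE ler_pdivrMr ?mass_gt0 //.
rewrite /energy /mass /weighted_sum !mxE /= !subrr normr0 powR0; last by lra.
have := powR_convex_norm (y 0 0) (- y 0 1) p1; rewrite normrN.
rewrite (distrC (y 0 1)); lra.
Qed.

Lemma minmax_le_plane p (idx : set 'rV[R]_6 -> \bar R) k : 1 <= p -> (k <= 2)%N ->
  (2%:R%:E <= idx (embedded_circle plane_embedding))%E ->
  (minmax graph6 p idx k <= (2 / 5 * 2 `^ (p - 1))%:E)%E.
Proof.
move=> p1 k2 idx2; set S := embedded_circle _ in idx2.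
have not0 : ~ S 0.
  exact: (embedded_circle_not0 plane_projectionN plane_embeddingK).
apply: (@le_trans _ _ (ereal_sup [set (rayleigh graph6 p x)%:E | x in S])).
  apply: ereal_inf_lbound; exists S => //; split=> //.
  - exact: embedded_circle_compact plane_embedding_continuous.
  - exact: embedded_circle_symmetric plane_embeddingN.
  - by apply: le_trans idx2; rewrite lee_fin ler_nat.
apply: ge_ereal_sup => _ [x Sx <-]; rewrite lee_fin; case: Sx (Sx) => y y1 <- Sx.
apply: rayleigh_plane => //; apply/eqP => y0; apply: not0; by rewrite -y0.
Qed.

Lemma row_continuous_at (T : topologicalType) (n : nat) (f : T -> 'rV[R]_n) (t : T) :
  (forall j, {for t, continuous (fun s : T => f s 0 j)}) -> {for t, continuous f}.
Proof.
move=> cf A [P Pft PA].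
have : \forall s \near t, forall j, P 0 j (f s 0 j).
  by apply: filter_forall => j; exact: (cf j (P 0 j) (Pft 0 j)).
by apply: filterS => s Ps; apply: PA => i j; rewrite (ord1 i).
Qed.

(** If the supremum on [S] is below [c], then [g] and x_2 - x_1 have no common zero on [S], and the
    normalised pair is an odd map to the circle. [g] is the moment for p > 1 and its clipped variant
    for p = 1. *)
Lemma minmax_ge_odd p c (g : 'rV[R]_6 -> R) (idx : set 'rV[R]_6 -> \bar R) k :
  continuous g -> (forall x, g (- x) = - g x) ->
  (forall x, x != 0 -> g x = 0 -> x 0 v1 = x 0 v2 -> c <= rayleigh graph6 p x) ->
  (forall S f, odd_continuous_map S (@sphere R 2) f -> (idx S <= 2%:R%:E)%E) ->
  (3 <= k)%N -> (c%:E <= minmax graph6 p idx k)%E.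
Proof.
move=> gc gN gP idx2 k3; apply: le_ereal_inf_tmp => _ [S [_ _ S0 kS] <-].
rewrite leNgt; apply/negP => Sc.
pose h x := x 0 v2 - x 0 v1.
have hc : continuous h.
  by move=> x; apply: (@cvgB _ _ _ (nbhs x)); exact: coord_continuous.
pose r x := Num.sqrt (g x ^+ 2 + h x ^+ 2).
have rc : continuous r.
  move=> x; apply: (@continuous_comp _ _ _ (fun x => g x ^+ 2 + h x ^+ 2)).
    apply: (@cvgD _ _ _ (nbhs x)).
      by apply: (@cvgM _ _ (nbhs x)); exact: gc.
    by apply: (@cvgM _ _ (nbhs x)); exact: hc.
  exact: sqrt_continuous.
have r0 x : S x -> 0 < g x ^+ 2 + h x ^+ 2.
  move=> Sx; rewrite lt_neqAle addr_ge0 ?sqr_ge0 // andbT eq_sym; apply/eqP => gh.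
  have h0 : h x = 0.
    have := sqr_ge0 (g x); have := sqr_ge0 (h x) => h0 g0.
    by apply/eqP; rewrite -sqrf_eq0; apply/eqP; lra.
  have g0 : g x = 0.
    by apply/eqP; rewrite -sqrf_eq0; apply/eqP; rewrite h0 in gh; move: gh; rewrite expr0n addr0.
  have x0 : x != 0 by apply/eqP => x0; apply: S0; rewrite -x0.
  have := gP x x0 g0; move/(_ _)/negP => hh.
  have : c <= rayleigh graph6 p x by apply: gP => //; move: h0; rewrite /h; lra.
  rewrite -lee_fin => cx.
  have : (c%:E < c%:E)%E.
    by apply: le_lt_trans Sc; apply: le_trans cx _; apply: ereal_sup_ubound; exists x.
  by rewrite ltxx.
pose f x : 'rV[R]_2 := \row_i ((if i == 0 then g x else h x) / r x).
have fP : odd_continuous_map S (@sphere R 2) f.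
  split=> [|x Sx|x Sx].
  - apply: continuous_in_subspaceT => x; rewrite inE => Sx.
    apply: row_continuous_at => j.
    rewrite (_ : (fun _ => _) = fun x => (if j == 0 then g x else h x) * (r x)^-1).
      apply: (@cvgM _ _ (nbhs x) _ (fun x => if j == 0 then g x else h x)).
        by case: (j == 0); [exact: gc|exact: hc].
      apply: (@cvgV _ _ (nbhs x)); last exact: rc.
      by rewrite gt_eqF // sqrtr_gt0 r0.
    by apply/funext => u; rewrite mxE.
  - rewrite sphere2E !mxE /= !exprMn exprVn sqr_sqrtr ?(ltW (r0 _ Sx)) // -mulrDl mulfV //.
    by rewrite gt_eqF // r0.
  apply/rowP => i; rewrite !mxE /r gN.
  have -> : h (- x) = - h x by rewrite /h !mxE; lra.
  by rewrite !sqrrN -mulNr; case: ifP.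
have := le_trans kS (idx2 S f fP); rewrite lee_fin ler_nat => k2.
by have := leq_trans k3 k2.
Qed.

(** Vertices 3, 4, 5 are each joined to both 1 and 2, and 2 covers the required 9/5. Vertex 6 has
    one such edge against 6/5; the missing 1/5 comes through vertex 5, at the factor 2^(p-1), and
    uses the 1/5 left over there. *)
Lemma energy_ge_merged p x : 1 <= p -> x 0 v1 = x 0 v2 ->
  3 / 5 * weighted_sum (fun t => `|t - x 0 v1| `^ p) x <= 2 `^ (p - 1) * energy p x.
Proof.
move=> p1 x12; rewrite /energy /weighted_sum -x12 subrr normr0 powR0; last by lra.
set T := 2 `^ (p - 1).
have T1 : 1 <= T by rewrite -(powRr0 2) ler_powR //; lra.
have := powR_convex_norm (x 0 v5 - x 0 v1) (x 0 v6 - x 0 v5) p1.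
rewrite addrC subrKA -/T !(distrC (x 0 v1)) (distrC (x 0 v6) (x 0 v5)).
set a := `|x 0 v3 - _| `^ p; set b := `|x 0 v4 - _| `^ p.
set c := `|x 0 v5 - x 0 v1| `^ p; set d := `|x 0 v6 - x 0 v1| `^ p.
set e := `|x 0 v3 - x 0 v4| `^ p; set f := `|x 0 v5 - x 0 v6| `^ p.
have a0 : 0 <= a := powR_ge0 _ _. have b0 : 0 <= b := powR_ge0 _ _.
have c0 : 0 <= c := powR_ge0 _ _. have d0 : 0 <= d := powR_ge0 _ _.
have e0 : 0 <= e := powR_ge0 _ _. have f0 : 0 <= f := powR_ge0 _ _.
move=> h.
have ha : a <= T * a by rewrite ler_peMl. have hb : b <= T * b by rewrite ler_peMl.
have hc : c <= T * c by rewrite ler_peMl. have hd : d <= T * d by rewrite ler_peMl.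
have he : 0 <= T * e by rewrite mulr_ge0 //; lra.
have hf : 0 <= T * f by rewrite mulr_ge0 //; lra.
lra.
Qed.

Definition translate c x : 'rV[R]_6 := \row_i (x 0 i - c).

(** Along the constants the linear term of [mass_tangent] is a multiple of the moment. *)
Lemma mass_le_translate p c x : 1 <= p -> moment p x = 0 ->
  mass p x <= mass p (translate c x).
Proof.
move=> p1 mx; apply: le_trans (mass_tangent (translate c x) x p1).
rewrite lerDl; set u := weighted_sum id _; suff -> : u = 0 by rewrite mulr0.
have -> : u = - c * moment p x; last by rewrite mx mulr0.
by rewrite /u /moment /weighted_sum !mxE; ring.
Qed.

Lemma rayleigh_moment0 p x : 1 < p -> x != 0 -> moment p x = 0 -> x 0 v1 = x 0 v2 ->
  3 / 5 <= rayleigh graph6 p x * 2 `^ (p - 1).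
Proof.
move=> p1 x0 mx x12; have p1' := ltW p1.
rewrite rayleighE mulrAC ler_pdivlMr ?mass_gt0 // (mulrC (energy p x)).
apply: le_trans (energy_ge_merged p1' x12); rewrite ler_pM2l; last by lra.
have := mass_le_translate (x 0 v1) p1' mx.
by rewrite [X in _ <= X]/mass /weighted_sum !mxE.
Qed.

(* [phi 1] is discontinuous at 0; for p = 1 a clipped identity takes its place. *)
Definition clip r t : R := Num.max (- r) (Num.min r t).

(** Divided by its threshold, the clipped identity approximates the sign. The threshold scales with
    the weighted norm of [x], so the error is relative. *)
Definition clipped_moment (eta : R) x : R :=
  weighted_sum (clip (eta * weighted_sum Num.norm x)) x.

Lemma clipN r t : 0 <= r -> clip r (- t) = - clip r t.
Proof.
move=> r0; rewrite /clip; have [h1|h1] := leP r t; have [h2|h2] := leP r (- t).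
- by have [] := leP (- r) r => ?; lra.
- have [] := leP (- r) (- t) => ?; have [] := leP (- r) r => ?; lra.
- have [] := leP (- r) r => ?; have [] := leP (- r) t => ?; lra.
have [] := leP (- r) (- t) => ?; have [] := leP (- r) t => ?; lra.
Qed.

(** [clip r t / r] is a subgradient of the absolute value at [t] up to an error [r]; the two bounds
    replace the tangent inequality of [mass_le_translate]. *)
Lemma clip_bounds r t u : 0 <= r ->
  clip r t * (t - u) <= r * `|t - u| /\ r * (`|t| - r) <= clip r t * t.
Proof.
move=> r0; have cr : `|clip r t| <= r.
  rewrite ler_norml /clip; apply/andP; split; first by rewrite le_max lexx.
  by rewrite ge_max ge_min lexx; lra.
split.
  apply: le_trans (ler_norm _) _; rewrite normrM ler_wpM2r //.
have [t0|t0] := leP 0 t; rewrite ?(ger0_norm t0) ?(ltr0_norm t0) /clip.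
  have [h|h] := leP r t; have [] := leP (- r) _ => ?; nra.
have [h|h] := leP r t; have [] := leP (- r) _ => ?; nra.
Qed.

Lemma clipped_moment_odd eta x : 0 <= eta ->
  clipped_moment eta (- x) = - clipped_moment eta x.
Proof.
move=> eta0; rewrite /clipped_moment /weighted_sum !mxE !normrN.
have r0 : 0 <= eta * (5 * `|x 0 v1| + 4 * `|x 0 v2| + 3 * `|x 0 v3| + 3 * `|x 0 v4| +
    3 * `|x 0 v5| + 2 * `|x 0 v6|).
  by rewrite mulr_ge0 // !addr_ge0 // mulr_ge0.
rewrite !clipN //; lra.
Qed.

(** [clip_bounds], summed with the degrees of total 20, shows that translation by x_1 lowers the
    weighted norm N by at most 20 eta N <= N/30. The constant is 3/5 times 29/30. *)
Lemma rayleigh_clipped_moment0 eta x : 0 < eta -> 20 * eta <= 1 / 30 ->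
  x != 0 -> clipped_moment eta x = 0 ->
  x 0 v1 = x 0 v2 -> 29 / 50 <= rayleigh graph6 1 x.
Proof.
move=> eta0 eta1 x0 + x12; have := energy_ge_merged (lexx 1) x12.
rewrite subrr powRr0 mul1r rayleighE ler_pdivlMr ?mass_gt0 // => hE hc.
apply: le_trans hE.
have := mass_gt0 1 x0; rewrite /mass.
have -> : weighted_sum (fun t => `|t| `^ 1) x = weighted_sum Num.norm x.
  by rewrite /weighted_sum !powRr1.
have -> : weighted_sum (fun t => `|t - x 0 v1| `^ 1) x =
    weighted_sum (fun t => `|t - x 0 v1|) x by rewrite /weighted_sum !powRr1.
move: hc; rewrite /clipped_moment; set N := weighted_sum Num.norm x.
set r := _ * N => hc N0; have r0 : 0 < r by exact: mulr_gt0.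
rewrite -(ler_pM2l r0).
have B i := clip_bounds (x 0 i) (x 0 v1) (ltW r0).
have [b1 c1] := B v1; have [b2 c2] := B v2; have [b3 c3] := B v3.
have [b4 c4] := B v4; have [b5 c5] := B v5; have [b6 c6] := B v6.
have rr : 20 * (r * r) <= 1 / 30 * (r * N).
  have := ler_wpM2r (ltW (mulr_gt0 r0 N0)) eta1; rewrite {3}/r; lra.
have := congr1 ( *%R (x 0 v1)) hc; move: rr.
rewrite mulr0 /N /weighted_sum; clearbody r.
lra.
Qed.

Lemma weighted_sum6_continuous (G : 'I_6 -> 'rV[R]_6 -> R) :
  (forall i, continuous (G i)) -> continuous (fun x => 5 * G v1 x + 4 * G v2 x +
    3 * G v3 x + 3 * G v4 x + 3 * G v5 x + 2 * G v6 x).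
Proof.
move=> Gc; have Mc k i : continuous (fun x => k * G i x).
  by move=> x; apply: (@cvgM _ _ (nbhs x)); [exact: cvg_cst|exact: Gc].
have Dc (a b : 'rV[R]_6 -> R) : continuous a -> continuous b ->
    continuous (fun x => a x + b x).
  by move=> ac bc x; apply: (@cvgD _ _ _ (nbhs x)); [exact: ac|exact: bc].
by do 5! [apply: (Dc _ (fun x => _ * _)) => //].
Qed.

Lemma weighted_sum_continuous (F : R -> R) : continuous F ->
  continuous (@weighted_sum R F).
Proof.
move=> Fc; apply: (@weighted_sum6_continuous (fun i x => F (x 0 i))) => i x.
apply: (@continuous_comp _ _ _ (fun x : 'rV[R]_6 => x 0 i) F); last exact: Fc.
exact: coord_continuous.
Qed.

Lemma clipped_moment_continuous eta : continuous (clipped_moment eta).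
Proof.
pose r x := eta * @weighted_sum R Num.norm x.
have rc : continuous r.
  move=> x; apply: (@cvgM _ _ (nbhs x)); first exact: cvg_cst.
  by apply: weighted_sum_continuous; exact: norm_continuous.
apply: (@weighted_sum6_continuous (fun i x => clip (r x) (x 0 i))) => i x.
apply: (@continuous_max _ _ (fun x => - r x) (fun x => Num.min (r x) (x 0 i))).
  by apply: (@cvgN _ _ _ (nbhs x)); exact: rc.
apply: (@continuous_min _ _ r (fun x => x 0 i)); first exact: rc.
exact: coord_continuous.
Qed.

(** For p > 1 the bound (3/5)(50/51) exceeds 29/50, which in turn is above 5/9 + 1/50. *)
Lemma minmax_ge_58 p (idx : set 'rV[R]_6 -> \bar R) k :
  1 <= p -> 2 `^ (p - 1) <= 51 / 50 :> R ->
  (forall S f, odd_continuous_map S (@sphere R 2) f -> (idx S <= 2%:R%:E)%E) ->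
  (3 <= k)%N -> ((29 / 50)%:E <= minmax graph6 p idx k)%E.
Proof.
move=> p1 T idx2 k3; move: p1; rewrite le_eqVlt => /orP[/eqP<-|p1].
  apply: (@minmax_ge_odd _ _ (clipped_moment (1 / 600))) => //.
  - exact: clipped_moment_continuous.
  - by move=> x; apply: clipped_moment_odd; lra.
  - by move=> x; apply: rayleigh_clipped_moment0; lra.
apply: (@minmax_ge_odd _ _ (moment p)) => //.
- by apply: weighted_sum_continuous; exact: phi_continuous.
- by move=> x; rewrite /moment /weighted_sum !mxE !phiN; lra.
move=> x x0 m0 x12; have := rayleigh_moment0 p1 x0 m0 x12.
have : 0 <= rayleigh graph6 p x.
  rewrite rayleighE divr_ge0 ?(ltW (mass_gt0 _ x0)) //.
  by rewrite /energy !addr_ge0 // powR_ge0.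
have : 0 < 2 `^ (p - 1) :> R by rewrite powR_gt0.
nra.
Qed.

End MinmaxBounds.

(** * Eigenvalues near 5/9 *)

Section Eigenvalue.
Variable R : realType.
Implicit Types (p c t lam : R) (x y z : 'rV[R]_6).

(** [x] is the indicator of A = {2,5,6}: five edges leave A, and its degrees sum to 9. The values of
    [w] on the edges 25 and 56 balance the equations on A, where Sgn is a single point; on the other
    vertices Sgn(0) leaves room. *)
Lemma plap_eigenvalue_1_59 : @plap_eigenvalue_1 R 6 graph6 (5 / 9).
Proof.
pose x : 'rV[R]_6 := \row_i (if val i \in [:: 1; 4; 5]%N then 1 else 0).
pose w (i j : nat) : R := match i, j with
  | 1, 4 => - (7 / 9) | 4, 5 => - (1 / 9) | 0, 2 | 0, 3 => 1 / 2 | 2, 3 => 0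
  | 1, _ => 1 | _, _ => - 1 end.
pose z (i j : 'I_6) : R := if (i < j)%N then w i j else - w j i.
exists x, z; split.
- apply/eqP => /rowP /(_ v2); rewrite !mxE /= => /eqP; rewrite oner_eq0 //.
- apply: vertex_ind; apply: vertex_ind => //= _; rewrite /z /w /x !mxE /= ?opprK; split => //;
    rewrite /Sgn ?subrr ?ltxx ?subr0 ?sub0r ?ltr01 ?ltrN10 ?oppr_gt0 ?ltr10 ?oppr_lt0 ?ltr01 //= in_itv /=; lra.
have zE i : \sum_(j < 6 | graph6 i j) z i j = \sum_j (if graph6 i j then z i j else 0).
  by rewrite big_mkcond.
have [d1 d2 d3 d4 [d5 d6]] := degree_graph6.
have S1 : @Sgn R 1 1 by rewrite /Sgn ltr01.
have S0 s : -1 <= s <= 1 -> @Sgn R 0 s by rewrite /Sgn ltxx /= in_itv.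
apply: vertex_ind; rewrite zE !sum_vertices /= /z /w /= /x !mxE /=
  ?d1 ?d2 ?d3 ?d4 ?d5 ?d6.
- exists (- (18 / 25)); [apply: S0; lra|lra].
- exists 1; [exact: S1|lra].
- exists (- (9 / 10)); [apply: S0; lra|lra].
- exists (- (9 / 10)); [apply: S0; lra|lra].
- exists 1; [exact: S1|lra].
- exists 1; [exact: S1|lra].
Qed.

Lemma phi_gt0 p t : 0 < t -> 0 < phi p t.
Proof. by move=> t0; rewrite phi_pos // powR_gt0. Qed.

Lemma phi_lt0 p t : t < 0 -> phi p t < 0.
Proof. by move=> t0; rewrite -[t]opprK phiN oppr_lt0 phi_gt0 // oppr_gt0. Qed.

(** A large translation to either side gives all entries one sign, so each class modulo constants
    meets the zero set of the moment. *)
Lemma moment_translate_eq0 p x : 1 < p -> exists c, moment p (translate c x) = 0.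
Proof.
move=> p1; pose h c := moment p (translate c x).
pose B := weighted_sum Num.norm x + 1.
have hc : continuous h.
  move=> c; apply: (@continuous_comp R 'rV[R]_6 R (fun c => translate c x) (moment p)); last first.
    by apply: weighted_sum_continuous; exact: phi_continuous.
  apply: row_continuous => j; rewrite (_ : (fun _ => _) = fun c => x 0 j - c).
    by move=> d; apply: (@cvgB _ _ _ (nbhs d)); [exact: cvg_cst|exact: cvg_id].
  by apply/funext => d; rewrite mxE.
have xB i : - B < x 0 i < B.
  rewrite -ltr_norml /B /weighted_sum.
  have n j : 0 <= `|x 0 j| := normr_ge0 _; have := n v1; have := n v2; have := n v3.
  have := n v4; have := n v5; have := n v6.
  move: i; apply: vertex_ind; lra.
have B0 : 0 < B by have := xB v1 => /andP[]; lra.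
have hB : h B < 0.
  have neg i : phi p (x 0 i - B) < 0 by apply: phi_lt0; have /andP[] := xB i; lra.
  rewrite /h /moment /weighted_sum !mxE.
  have := neg v1; have := neg v2; have := neg v3; have := neg v4; have := neg v5.
  have := neg v6; lra.
have hNB : 0 < h (- B).
  have pos i : 0 < phi p (x 0 i - - B) by apply: phi_gt0; have /andP[] := xB i; lra.
  rewrite /h /moment /weighted_sum !mxE.
  have := pos v1; have := pos v2; have := pos v3; have := pos v4; have := pos v5.
  have := pos v6; lra.
have [|||c _ hc0] := @IVT R h (- B) B 0; [by lra|exact: continuous_subspaceT| |by exists c].
by rewrite ge_min le_max (ltW hB) (ltW hNB) orbT.
Qed.

(** This replaces the vanishing of a derivative at a minimum: a nonzero sign of [r 0] would persist
    near 0 and clash with one sign of t. *)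
Lemma sign_stationary (r : R -> R) : {for 0, continuous r} ->
  (\forall t \near 0, 0 <= t * r t) -> r 0 = 0.
Proof.
move=> rc tr.
have [r0|r0|//] := ltgtP (r 0) 0.
  have : \forall t \near 0, r t < 0 by apply: (cvgr_lt _ rc).
  move=> /(filterI tr) /nbhs_ballP[d /= d0 dP].
  have [] := dP (d / 2); first by rewrite -ball_normE /= sub0r normrN gtr0_norm; lra.
  by rewrite pmulr_rge0 ?divr_gt0 // leNgt => /negP.
have : \forall t \near 0, 0 < r t by apply: (cvgr_gt _ rc).
move=> /(filterI tr) /nbhs_ballP[d /= d0 dP].
have [] := dP (- (d / 2)).
  by rewrite -ball_normE /= sub0r opprK gtr0_norm; lra.
by rewrite mulNr oppr_ge0 pmulr_rle0 ?divr_gt0 // leNgt => /negP.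
Qed.

(** Under x_6 - x_1 = 1, a neighbourhood of the indicator of A modulo constants. *)
Definition box x := [/\ `|x 0 v2 - x 0 v6| <= 1 / 4, `|x 0 v5 - x 0 v6| <= 1 / 4,
  `|x 0 v3 - x 0 v1| <= 1 / 4 & `|x 0 v4 - x 0 v1| <= 1 / 4].

(** The variation along the trees 2-5-6 in A and 3-1-4 in B; it bounds the four quantities of
    [box]. *)
Definition spread x := `|x 0 v2 - x 0 v5| + `|x 0 v5 - x 0 v6| +
  `|x 0 v1 - x 0 v3| + `|x 0 v1 - x 0 v4|.

(** The strict local minimum at p = 1 in quantitative form, with [spread] as the gain. In the box
    the signs of x_i - c are known, so once the vertex attaining c is fixed the estimate is
    linear. *)
Lemma energy1_box x : x 0 v6 - x 0 v1 = 1 -> box x -> exists c,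
  let m := weighted_sum (fun t => `|t - c|) x in
  [/\ forall i, `|x 0 i - c| <= 2, 1 <= m, m <= 40 &
      5 / 9 * m + 2 / 9 * spread x <=
      `|x 0 v1 - x 0 v2| + `|x 0 v1 - x 0 v3| + `|x 0 v1 - x 0 v4| +
      `|x 0 v1 - x 0 v5| + `|x 0 v1 - x 0 v6| + `|x 0 v2 - x 0 v3| +
      `|x 0 v2 - x 0 v4| + `|x 0 v2 - x 0 v5| + `|x 0 v3 - x 0 v4| +
      `|x 0 v5 - x 0 v6|].
Proof.
move=> x61 [b2 b5 b3 b4]; rewrite /spread.
move: b2 b5 b3 b4; rewrite !ler_norml.
move=> /andP[b2 b2'] /andP[b5 b5'] /andP[b3 b3'] /andP[b4 b4'].
(* The maximum over B is a weighted median: A has degree sum 9, less than half of 20, and the vertex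
   attaining the maximum adds at least 3. *)
pose c := Num.max (x 0 v1) (Num.max (x 0 v3) (x 0 v4)); exists c; set m := weighted_sum _ x.
have c1 : x 0 v1 <= c by rewrite le_max lexx.
have c3 : x 0 v3 <= c by rewrite !le_max lexx !orbT.
have c4 : x 0 v4 <= c by rewrite !le_max lexx !orbT.
have cc : [\/ c = x 0 v1, c = x 0 v3 | c = x 0 v4].
  by rewrite /c; have [_|_] := leP (x 0 v1); [have [_|_] := leP (x 0 v3)|];
    [apply: Or33|apply: Or32|apply: Or31].
have cle : c <= x 0 v1 + 1 / 4 by case: cc => ->; lra.
have n1 : `|x 0 v1 - c| = c - x 0 v1 by rewrite ler0_norm ?opprB //; lra.
have n3 : `|x 0 v3 - c| = c - x 0 v3 by rewrite ler0_norm ?opprB //; lra.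
have n4 : `|x 0 v4 - c| = c - x 0 v4 by rewrite ler0_norm ?opprB //; lra.
have n2 : `|x 0 v2 - c| = x 0 v2 - c by rewrite ger0_norm //; lra.
have n5 : `|x 0 v5 - c| = x 0 v5 - c by rewrite ger0_norm //; lra.
have n6 : `|x 0 v6 - c| = x 0 v6 - c by rewrite ger0_norm //; lra.
have mE : m = 5 * (c - x 0 v1) + 4 * (x 0 v2 - c) + 3 * (c - x 0 v3) +
  3 * (c - x 0 v4) + 3 * (x 0 v5 - c) + 2 * (x 0 v6 - c).
  by rewrite /m /weighted_sum n1 n2 n3 n4 n5 n6.
split.
- by apply: vertex_ind; rewrite ?n1 ?n2 ?n3 ?n4 ?n5 ?n6; lra.
- rewrite mE; lra.
- rewrite mE; lra.
have ub (a b : R) : a - b <= `|a - b| /\ b - a <= `|a - b|.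
  by rewrite ler_norm -[b - a]opprB -normrN ler_norm.
rewrite mE; have [_ k12] := ub (x 0 v1) (x 0 v2); have [_ k15] := ub (x 0 v1) (x 0 v5).
have [_ k16] := ub (x 0 v1) (x 0 v6); have [k23 _] := ub (x 0 v2) (x 0 v3).
have [k24 _] := ub (x 0 v2) (x 0 v4).
have [k13 k13'] := ub (x 0 v1) (x 0 v3); have [k14 k14'] := ub (x 0 v1) (x 0 v4).
have [k25 k25'] := ub (x 0 v2) (x 0 v5); have [k34 k34'] := ub (x 0 v3) (x 0 v4).
have [k56 k56'] := ub (x 0 v5) (x 0 v6).
by case: cc => e; rewrite e in c1 c3 c4 *; lra.
Qed.

(** As the moment vanishes, the mass is at most that of the translate by c, whose entries are
    bounded by 2 as [powR_le2] requires. Each of the ten edges loses at most p - 1 by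
    [powR_geB1]. *)
Lemma energy_box p x : 1 <= p -> x 0 v6 - x 0 v1 = 1 -> box x -> moment p x = 0 ->
  exists m, [/\ 1 <= m, m <= 40, mass p x <= 2 `^ (p - 1) * m &
    5 / 9 * m + 2 / 9 * spread x - 10 * (p - 1) <= energy p x].
Proof.
move=> p1 x61 bx mx; have [c [c2 m1 m40 e1]] := energy1_box x61 bx.
move: m1 m40 e1; set m := weighted_sum _ x => m1 m40 e1; exists m; split=> //.
  apply: le_trans (mass_le_translate c p1 mx) _.
  have P i := powR_le2 p1 (normr_ge0 (x 0 i - c)) (c2 i).
  have := P v1; have := P v2; have := P v3; have := P v4; have := P v5; have := P v6.
  rewrite /mass /m /weighted_sum !mxE; lra.
have P i j := powR_geB1 p1 (normr_ge0 (x 0 i - x 0 j)).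
have := P v1 v2; have := P v1 v3; have := P v1 v4; have := P v1 v5; have := P v1 v6.
have := P v2 v3; have := P v2 v4; have := P v2 v5; have := P v3 v4; have := P v5 v6.
rewrite /energy; lra.
Qed.

Lemma energy_translate p c x : energy p (translate c x) = energy p x.
Proof.
have e (a b : R) : a - c - (b - c) = a - b by ring.
by rewrite /energy !mxE !e.
Qed.

Lemma box_translate c x : box x -> box (translate c x).
Proof.
have e (a b : R) : a - c - (b - c) = a - b by ring.
by rewrite /box !mxE !e.
Qed.

(** The first condition fixes the scale and the last one the translate; on this set F_p equals
    G_p. *)
Definition admissible p : set 'rV[R]_6 :=
  [set x : 'rV[R]_6 | [/\ x 0 v6 - x 0 v1 = 1, box x & moment p x = 0]].

Lemma admissible_neq0 p x : admissible p x -> x != 0.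
Proof.
move=> [x61 _ _]; apply/eqP => x0; move: x61; rewrite x0 !mxE subrr => /esym/eqP.
by rewrite oner_eq0.
Qed.

(** All entries are within 5/4 of x_1, and a vanishing moment forbids that they are all positive or
    all negative. *)
Lemma admissible_bounded p x : admissible p x -> forall i, `|x 0 i| <= 4.
Proof.
move=> [x61 [b2 b5 b3 b4] mx].
move: b2 b5 b3 b4; rewrite !ler_norml.
move=> /andP[b2 b2'] /andP[b5 b5'] /andP[b3 b3'] /andP[b4 b4'].
have lo : - 2 < x 0 v1.
  rewrite ltNge; apply/negP => h; have neg i : x 0 i < 0 -> phi p (x 0 i) < 0 by exact: phi_lt0.
  have h1 : phi p (x 0 v1) < 0 by apply: neg; lra.
  have h2 : phi p (x 0 v2) < 0 by apply: neg; lra.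
  have h3 : phi p (x 0 v3) < 0 by apply: neg; lra.
  have h4 : phi p (x 0 v4) < 0 by apply: neg; lra.
  have h5 : phi p (x 0 v5) < 0 by apply: neg; lra.
  have h6 : phi p (x 0 v6) < 0 by apply: neg; lra.
  move: mx; rewrite /moment /weighted_sum; lra.
have hi : x 0 v1 < 2.
  rewrite ltNge; apply/negP => h; have pos i : 0 < x 0 i -> 0 < phi p (x 0 i) by exact: phi_gt0.
  have h1 : 0 < phi p (x 0 v1) by apply: pos; lra.
  have h2 : 0 < phi p (x 0 v2) by apply: pos; lra.
  have h3 : 0 < phi p (x 0 v3) by apply: pos; lra.
  have h4 : 0 < phi p (x 0 v4) by apply: pos; lra.
  have h5 : 0 < phi p (x 0 v5) by apply: pos; lra.
  have h6 : 0 < phi p (x 0 v6) by apply: pos; lra.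
  move: mx; rewrite /moment /weighted_sum; lra.
by move=> i; rewrite ler_norml; apply/andP; move: i; apply: vertex_ind; split; lra.
Qed.

Lemma coord_diff_continuous i j : continuous (fun x : 'rV[R]_6 => x 0 i - x 0 j).
Proof. by move=> x; apply: (@cvgB _ _ _ (nbhs x)); exact: coord_continuous. Qed.

Lemma closed_preimage (f : 'rV[R]_6 -> R) (A : set R) :
  continuous f -> closed A -> closed (f @^-1` A).
Proof. by move=> fc Ac; apply: closed_comp => // x _; exact: fc. Qed.

Lemma admissible_compact p : 1 < p -> compact (admissible p).
Proof.
move=> p1; apply: bounded_closed_compact.
  exists 4; split; first exact: num_real.
  move=> M M4 x /admissible_bounded x4 /=; apply: ltW; apply: rV_norm_lt; first by lra.
  by move=> i; apply: le_lt_trans M4; exact: x4.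
have nc i j : continuous (fun x : 'rV[R]_6 => `|x 0 i - x 0 j|).
  move=> x; apply: (@continuous_comp 'rV[R]_6 R R (fun x => x 0 i - x 0 j) Num.norm).
    exact: coord_diff_continuous.
  exact: norm_continuous.
pose N i j := (fun x : 'rV[R]_6 => `|x 0 i - x 0 j|) @^-1` [set r | r <= 1 / 4].
have Nc i j : closed (N i j) by apply: closed_preimage; [exact: nc|exact: closed_le].
rewrite (_ : admissible p = (fun x : 'rV[R]_6 => x 0 v6 - x 0 v1) @^-1` [set 1] `&`
   ((N v2 v6 `&` N v5 v6) `&` (N v3 v1 `&` N v4 v1)) `&` (moment p @^-1` [set 0])).
  apply: closedI; last first.
    apply: closed_preimage; last exact: closed_eq.
    by apply: weighted_sum_continuous; exact: phi_continuous.
  apply: closedI; last by do !apply: closedI.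
  by apply: closed_preimage; [exact: coord_diff_continuous|exact: closed_eq].
by apply/seteqP; split=> x; rewrite /N /admissible /box /=; [case=> ? [] | case=> -[? [[? ?] [? ?]]] ?].
Qed.

Lemma energy_continuous p : 1 <= p -> continuous (@energy R p).
Proof.
move=> p1; have p0 : 0 < p by lra.
have nc i j : continuous (fun x : 'rV[R]_6 => `|x 0 i - x 0 j| `^ p).
  move=> x; apply: (@continuous_comp 'rV[R]_6 R R (fun x => x 0 i - x 0 j) (fun t => `|t| `^ p)).
    exact: coord_diff_continuous.
  exact: powR_norm_continuous.
have Dc (a b : 'rV[R]_6 -> R) : continuous a -> continuous b ->
    continuous (fun x => a x + b x).
  by move=> ac bc x; apply: (@cvgD _ _ _ (nbhs x)); [exact: ac|exact: bc].
by do 9! [apply: (Dc _ (fun x => _ `^ _)) => //].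
Qed.

Lemma rayleigh_continuous_at p x : 1 <= p -> x != 0 ->
  {for x, continuous (rayleigh graph6 p : 'rV[R]_6 -> R)}.
Proof.
move=> p1 x0; rewrite (_ : rayleigh graph6 p = fun x => energy p x * (mass p x)^-1).
  apply: (@cvgM _ _ (nbhs x)); first exact: energy_continuous.
  apply: (@cvgV _ _ (nbhs x)); first by rewrite gt_eqF // mass_gt0.
  by apply: weighted_sum_continuous; apply: powR_norm_continuous; lra.
by apply/funext => y; rewrite rayleighE.
Qed.

(** A translate of the indicator of A has energy 5 and mass 9|1-c|^p + 11|c|^p, while 1 <= 2^(p-1)
    (|1-c|^p + |c|^p). *)
Lemma admissible_center p : 1 < p ->
  exists2 x, admissible p x & rayleigh graph6 p x <= 5 / 9 * 2 `^ (p - 1).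
Proof.
move=> p1; pose x0 : 'rV[R]_6 := \row_i (if val i \in [:: 1; 4; 5]%N then 1 else 0).
have [c mc] := moment_translate_eq0 x0 p1.
have ax : admissible p (translate c x0).
  by split=> //; [rewrite !mxE /=; ring|apply: box_translate; rewrite /box !mxE /= !subrr normr0; split; lra].
exists (translate c x0) => //.
rewrite rayleighE ler_pdivrMr ?mass_gt0 ?(admissible_neq0 ax) // energy_translate.
rewrite /energy /mass /weighted_sum !mxE /= !subrr normr0 powR0; last by lra.
rewrite !sub0r subr0 !normrN normr1 powR1.
have := powR_convex_norm (1 - c) c (ltW p1); rewrite subrK normr1 powR1.
have : 0 <= 2 `^ (p - 1) * `|c| `^ p by rewrite mulr_ge0 ?powR_ge0.
lra.
Qed.

End Eigenvalue.

(** * The minimiser on the slice is an eigenvector *)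

Section EigenvalueExistence.
Variable R : realType.
Implicit Types (p c t lam : R) (x y z : 'rV[R]_6).

Lemma weighted_sumE (F : R -> R) x :
  weighted_sum F x = \sum_i (degree graph6 i)%:R * F (x 0 i).
Proof.
have [d1 d2 d3 d4 [d5 d6]] := degree_graph6.
by rewrite sum_vertices d1 d2 d3 d4 d5 d6 /weighted_sum !addrA.
Qed.

Lemma sum_plaplacian0 p x : \sum_i plaplacian graph6 p x i = 0.
Proof.
have [l1 l2 l3 l4 [l5 l6]] := plaplacianE p x.
by rewrite sum_vertices l1 l2 l3 l4 l5 l6; ring.
Qed.

Lemma euler_plaplacian p x : 0 < p ->
  \sum_i x 0 i * plaplacian graph6 p x i = energy p x.
Proof.
move=> p0; have [l1 l2 l3 l4 [l5 l6]] := plaplacianE p x.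
rewrite sum_vertices l1 l2 l3 l4 l5 l6 /energy -!(mulr_phi _ p0); ring.
Qed.

Lemma plaplacian_continuous p i : 1 < p ->
  continuous (fun x : 'rV[R]_6 => plaplacian graph6 p x i).
Proof.
move=> p1; apply: continuous_big; first exact: add_continuous.
move=> j _ x; apply: (@continuous_comp 'rV[R]_6 R R (fun x => x 0 i - x 0 j) (phi p)).
  exact: coord_diff_continuous.
exact: phi_continuous.
Qed.

Definition perturb x i t : 'rV[R]_6 := \row_j (x 0 j + t * (j == i)%:R).

Lemma perturb_continuous x i : continuous (perturb x i).
Proof.
apply: row_continuous => j; rewrite (_ : (fun _ => _) = fun t => x 0 j + t * (j == i)%:R).
  move=> t; apply: (@cvgD _ _ _ (nbhs t)); first exact: cvg_cst.
  by apply: (@cvgM _ _ (nbhs t)); [exact: cvg_id|exact: cvg_cst].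
by apply/funext => t; rewrite mxE.
Qed.

Definition strict_box x := [/\ `|x 0 v2 - x 0 v6| < 1 / 4, `|x 0 v5 - x 0 v6| < 1 / 4,
  `|x 0 v3 - x 0 v1| < 1 / 4 & `|x 0 v4 - x 0 v1| < 1 / 4].

Lemma perturb_box x i : strict_box x -> \forall t \near 0, box (perturb x i t).
Proof.
move=> [b1 b2 b3 b4].
have dc j k : continuous (fun t => `|perturb x i t 0 j - perturb x i t 0 k|).
  move=> t; apply: (@continuous_comp R R R (fun t => perturb x i t 0 j - perturb x i t 0 k) Num.norm).
    apply: (@continuous_comp R 'rV[R]_6 R (perturb x i) (fun x => x 0 j - x 0 k)).
      exact: perturb_continuous.
    exact: coord_diff_continuous.
  exact: norm_continuous.
have near_lt j k : `|x 0 j - x 0 k| < 1 / 4 ->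
    \forall t \near 0, `|perturb x i t 0 j - perturb x i t 0 k| < 1 / 4.
  by move=> h; apply: (cvgr_lt _ (dc j k 0)); rewrite !mxE !mul0r !addr0.
have h1 := near_lt _ _ b1; have h2 := near_lt _ _ b2.
have h3 := near_lt _ _ b3; have h4 := near_lt _ _ b4.
near=> t; split; apply: ltW; near: t => //.
Unshelve. all: by end_near. Qed.

(* The tangent inequalities for energy and mass replace differentiation. The
   translation that returns the perturbed vector to the slice has no
   first-order effect on the mass, because the moment of x vanishes. *)
Lemma interior_minimiser_eq p x lam i : 1 < p -> 0 <= lam -> i != v1 -> i != v6 ->
  admissible p x -> strict_box x -> energy p x = lam * mass p x ->
  (forall z, admissible p z -> lam * mass p z <= energy p z) ->
  plaplacian graph6 p x i = lam * (degree graph6 i)%:R * phi p (x 0 i).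
Proof.
move=> p1 lam0 i1 i6 [x61 bx mx] sx ex minx; have p1' := ltW p1.
(* The Laplacian is taken at the perturbed point y because the tangent inequality at y bounds the
   energy of y from above; minimality then gives p t r(t) >= 0 without a remainder. *)
pose r t := plaplacian graph6 p (perturb x i t) i - lam * (degree graph6 i)%:R * phi p (x 0 i).
have x0 : perturb x i 0 = x by apply/rowP => j; rewrite mxE mul0r addr0.
suff : r 0 = 0 by rewrite /r x0 => /eqP; rewrite subr_eq0 => /eqP.
apply: sign_stationary.
  apply: (@cvgB _ _ _ (nbhs (0 : R))); last exact: cvg_cst.
  apply: (@continuous_comp R 'rV[R]_6 R (perturb x i) (fun x => plaplacian graph6 p x i)).
    exact: perturb_continuous.
  exact: plaplacian_continuous.
have := perturb_box i sx; apply: filterS => t bt.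
set y := perturb x i t in bt *; have [c mc] := moment_translate_eq0 y p1.
have az : admissible p (translate c y).
  split=> //; last exact: box_translate.
  by rewrite !mxE ![_ == i]eq_sym (negbTE i1) (negbTE i6) !mulr0 !addr0 -x61; ring.
have := minx _ az; rewrite energy_translate => h1.
have h2 : energy p y <= energy p x + p * (t * plaplacian graph6 p y i).
  have := energy_tangent x y p1'.
  rewrite (bigD1 i) //= big1 => [|j ji]; last first.
    by rewrite /y !mxE (negbTE ji) mulr0 addr0 subrr mulr0.
  rewrite addr0 {3}/y !mxE eqxx mulr1; lra.
have h3 : mass p x + p * (t * ((degree graph6 i)%:R * phi p (x 0 i))) <= mass p (translate c y).
  apply: le_trans (mass_tangent (translate c y) x p1'); rewrite lerD2l ler_pM2l; last by lra.
  rewrite weighted_sumE; move: mx; rewrite /moment weighted_sumE => mx.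
  have -> : \sum_j (degree graph6 j)%:R * id ((\row_k (phi p (x 0 k) * (translate c y 0 k - x 0 k))) 0 j)
    = \sum_j (degree graph6 j)%:R * phi p (x 0 j) * (t * (j == i)%:R) - c * \sum_j (degree graph6 j)%:R * phi p (x 0 j).
    rewrite mulr_sumr -sumrB; apply: eq_bigr => j _; rewrite !mxE; ring.
  rewrite mx mulr0 subr0 (bigD1 i) //= big1 => [|j /negbTE ->]; last by rewrite !mulr0.
  by rewrite eqxx mulr1 addr0 mulrC.
have := ler_wpM2l lam0 h3 => h4.
have p0 : 0 < p by lra.
rewrite -(pmulr_rge0 _ p0) /r -/y; lra.
Qed.

(** [lam] is the minimum of F_p over the admissible set. Comparing [admissible_center] with
    [energy_box] at the minimiser puts it in the interior of the box and bounds [lam] from below. *)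
Lemma plap_eigenvalue_gt1_near59 p eps : 0 < eps -> eps <= 1 / 50 -> 1 < p ->
  p - 1 <= eps / 50 -> exists lam, [/\ 5 / 9 - eps < lam, lam < 5 / 9 + eps &
    plap_eigenvalue_gt1 graph6 p lam].
Proof.
move=> eps0 eps1 p1 pe; have p1' := ltW p1.
have [w aw rw] := admissible_center p1.
have [||x] := @EVT_min_rV R 6 (rayleigh graph6 p) (admissible p) _ (admissible_compact p1).
- by exists w.
- apply: continuous_in_subspaceT => x; rewrite inE => /admissible_neq0 x0.
  exact: rayleigh_continuous_at.
rewrite inE => ax minx; set lam := rayleigh graph6 p x in minx.
have x0 := admissible_neq0 ax; have Mx := mass_gt0 p x0.
have ex : energy p x = lam * mass p x by rewrite /lam rayleighE divfK ?gt_eqF.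
have minz z : admissible p z -> lam * mass p z <= energy p z.
  move=> az; have Mz := mass_gt0 p (admissible_neq0 az).
  by have := minx z; rewrite inE (rayleighE _ z) ler_pdivlMr // => /(_ az).
set T := 2 `^ (p - 1) in rw.
have T2 : T <= 1 + (p - 1) by apply: powR2_le_linear; apply/andP; split; lra.
have T1 : 1 <= T by rewrite -(powRr0 2) ler_powR //; lra.
have lamT : lam <= 5 / 9 * T by apply: le_trans rw; apply: minx; rewrite inE.
have lam0 : 0 <= lam.
  by rewrite /lam rayleighE divr_ge0 ?(ltW Mx) // /energy !addr_ge0 // powR_ge0.
have [x61 bx mx] := ax.
have [m [m1 m40 mT eT]] := energy_box p1' x61 bx mx.
have lm : lam * mass p x <= lam * (T * m) by exact: ler_wpM2l.
have sx0 : 0 <= spread x by rewrite /spread !addr_ge0.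
pose d := p - 1.
have Tm0 : 0 <= T * m by apply: mulr_ge0; lra.
have d0 : 0 < d by rewrite /d; lra.
have dm : d * m <= d * 40 by rewrite ler_pM2l.
have dm0 : d <= d * m by rewrite -{1}[d]mulr1 ler_pM2l.
(* From 5/9 m + 2/9 spread - 10 d <= 5/9 T^2 m, m <= 40 and T^2 <= 1 + 3 d, the spread is at most
   345 d, and d <= 1/2500. *)
have sx : spread x < 1 / 4.
  rewrite ltNge; apply/negP => s4.
  have TT : T * T <= 1 + 3 * d.
    have : T * T <= (1 + d) * (1 + d) by apply: ler_pM => //; lra.
    have : d * d <= d by rewrite -{3}[d]mulr1 ler_pM2l // /d; lra.
    lra.
  have TTm : T * T * m <= (1 + 3 * d) * m by apply: ler_wpM2r => //; lra.
  have h : lam * (T * m) <= 5 / 9 * T * (T * m) by exact: ler_wpM2r.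
  move: eT TTm h lm dm; rewrite ex -/d -/T; move: pe; rewrite -/d; lra.
have sbx : strict_box x.
  have n i j : 0 <= `|x 0 i - x 0 j| := normr_ge0 _.
  move: sx; rewrite /spread (distrC (x 0 v1) (x 0 v3)) (distrC (x 0 v1) (x 0 v4)) => sx.
  have tri := ler_distD (x 0 v5) (x 0 v2) (x 0 v6).
  have := n v2 v5; have := n v5 v6; have := n v3 v1; have := n v4 v1 => *.
  by split; lra.
exists lam; split.
(* Dividing lam T m >= 5/9 m - 10 d by m >= 1 shows that [lam] falls below 5/9 by at most a multiple
   of d. *)
- rewrite ltNge; apply/negP => lam_le.
  have Tm : T * m <= (1 + d) * m by apply: ler_wpM2r => //; lra.
  have h1 : lam * (T * m) <= lam * ((1 + d) * m) by exact: ler_wpM2l.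
  have h2 : lam * ((1 + d) * m) <= (5 / 9 - eps) * ((1 + d) * m).
    by apply: ler_wpM2r => //; apply: mulr_ge0; lra.
  have h3 : eps * 1 <= eps * m by rewrite ler_pM2l.
  have h4 : 0 <= eps * (d * m) by apply: mulr_ge0; lra.
  have h5 : (eps / 50 - d) * m >= 0 by apply: mulr_ge0; rewrite /d; lra.
  move: eT lm h1 h2 h3 h4 h5 dm0 pe; rewrite ex -/d -/T; lra.
- apply: le_lt_trans lamT _; lra.
exists x; split=> //.
have eq i : i != v1 -> i != v6 ->
    plaplacian graph6 p x i = lam * (degree graph6 i)%:R * phi p (x 0 i).
  by move=> i1 i6; exact: interior_minimiser_eq.
(* The two equations left out follow from summation against 1 and against x. *)
have p0 : 0 < p by lra.
have s0 := sum_plaplacian0 p x; have s1 := euler_plaplacian x p0.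
have M0 := mx; have M1 : mass p x = \sum_i (degree graph6 i)%:R * (x 0 i * phi p (x 0 i)).
  by rewrite /mass weighted_sumE; apply: eq_bigr => i _; rewrite mulr_phi.
move: M0; rewrite /moment weighted_sumE => M0.
pose r i := plaplacian graph6 p x i - lam * (degree graph6 i)%:R * phi p (x 0 i).
have r0 : \sum_i r i = 0.
  transitivity (\sum_i plaplacian graph6 p x i -
      lam * \sum_i (degree graph6 i)%:R * phi p (x 0 i)); last by rewrite s0 M0 mulr0 subr0.
  by rewrite mulr_sumr -sumrB; apply: eq_bigr => i _; rewrite /r mulrA.
have r1 : \sum_i x 0 i * r i = 0.
  transitivity (energy p x - lam * mass p x); last by rewrite ex subrr.
  by rewrite -s1 M1 mulr_sumr -sumrB; apply: eq_bigr => i _; rewrite /r; ring.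
have rz i : i != v1 -> i != v6 -> r i = 0 by move=> i1 i6; rewrite /r eq // subrr.
move: r0 r1; rewrite !sum_vertices (rz v2) // (rz v3) // (rz v4) // (rz v5) // !mulr0 !add0r => r0 r1.
have r6 : r v6 = 0.
  have : (x 0 v6 - x 0 v1) * r v6 = 0 by rewrite mulrBl; nra.
  by rewrite x61 mul1r.
have r1' : r v1 = 0 by lra.
move=> i; have [->|i1] := eqVneq i v1; first by move: r1'; rewrite /r; lra.
have [->|i6] := eqVneq i v6; first by move: r6; rewrite /r; lra.
exact: eq.
Qed.

End EigenvalueExistence.

Theorem theorem1p2 (R : realType) (eps : R) (heps0 : 0 < eps)
    (heps1 : eps < 1 / 10) :
  exists delta : R, 0 < delta /\ delta < 1 /\
    forall p : R, 1 <= p -> p < 1 + delta ->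
      exists lam : R,
        5 / 9 - eps < lam /\ lam < 5 / 9 + eps /\
        plap_eigenvalue graph6 p lam /\
        forall k : nat, (1 <= k)%N -> (k <= 6)%N ->
          lam%:E <> minmax graph6 p (@yang_index R 6) k /\
          lam%:E <> minmax graph6 p (@genus_minus R 6) k /\
          lam%:E <> minmax graph6 p (@genus_plus R 6) k.
Proof.
(* The cap 1/50 keeps the window around 5/9 between (2/5)(51/50) and 29/50, the bounds for k <= 2
   and for k >= 3. *)
pose e := Num.min eps (1 / 50).
have e0 : 0 < e by rewrite lt_min heps0; lra.
have ee : e <= eps by rewrite ge_min lexx.
have e1 : e <= 1 / 50 by rewrite ge_min lexx orbT.
exists (e / 50); split; first by lra.
split; first by lra.
move=> p p1 pe.
have [lam [lam1 lam2 eig]] : exists lam, [/\ 5 / 9 - e < lam, lam < 5 / 9 + e &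
    plap_eigenvalue graph6 p lam].
  rewrite /plap_eigenvalue; case: eqVneq => [_|pn1].
    by exists (5 / 9); split; [lra|lra|exact: plap_eigenvalue_1_59].
  by apply: plap_eigenvalue_gt1_near59 => //; [rewrite lt_neqAle eq_sym pn1|lra].
exists lam; split; first by lra.
split; first by lra.
split=> // k k1 k6.
have T : 2 `^ (p - 1) <= 51 / 50 :> R.
  by apply: le_trans (powR2_le_linear _) _; [apply/andP; split|]; lra.
have avoid (idx : set 'rV[R]_6 -> \bar R) :
    (2%:R%:E <= idx (embedded_circle (@plane_embedding R)))%E ->
    (forall S f, odd_continuous_map S (@sphere R 2) f -> (idx S <= 2%:R%:E)%E) ->
    lam%:E <> minmax graph6 p idx k.
  move=> idx_ge idx_le lamE; have [k2|k3] := leqP k 2.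
    have := minmax_le_plane p1 k2 idx_ge; rewrite -lamE lee_fin; lra.
  have := minmax_ge_58 p1 T idx_le k3; rewrite -lamE lee_fin; lra.
split; last split; apply: avoid.
- apply: yang_index_embedded_circle.
  + exact: plane_embedding_continuous.
  + exact: plane_projection_continuous.
  + exact: plane_embeddingN.
  + exact: plane_projectionN.
  + exact: plane_embeddingK.
- exact: yang_index_le2.
- apply: genus_minus_embedded_circle.
  + exact: plane_embedding_continuous.
  + exact: plane_embeddingN.
- exact: genus_minus_le2.
- apply: genus_plus_embedded_circle.
  + exact: plane_embedding_continuous.
  + exact: plane_embeddingN.
exact: genus_plus_le2.
Qed.
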